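(* Let $k$ be a field of characteristic zero. For a colored quiver $\Upsilon$ with vertex set $I$ and color set $C$, together with an ordering of the colors at each vertex, consider the assertion $\mathbf{P}(\Upsilon)$: the Boalch algebra $\mathcal{B}(\Upsilon)$ carries a double quasi-Poisson bracket $\{\!\{-,-\}\!\}$ for which $$\Phi=\sum_{s\in I}\Phi_s,\qquad \Phi_s=\prod_{\{c\in C\,\mid\, s\in I_c\}}\gamma_{c,s}\in e_s\mathcal{B}(\Upsilon)e_s$$ (product in the chosen order at $s$) is a multiplicative moment map; in other words, $(\mathcal{B}(\Upsilon),\{\!\{-,-\}\!\},\Phi)$ is a Hamiltonian double quasi-Poisson algebra. If $\mathbf{P}(\Upsilon)$ holds for every monochromatic quiver $\Upsilon$, then $\mathbf{P}(\Upsilon)$ holds for every colored quiver $\Upsilon$.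
   Context: Colored quivers. A graph is complete $m$-partite if its vertex set is partitioned into $m$ nonempty parts $I_j$ and two vertices are joined by a single edge if and only if they lie in different parts (no other edges). Ordering the parts and the vertices in each part gives a total order on the vertices: $i<i'$ if $i\in I_j$, $i'\in I_{j'}$ with $j<j'$, or both lie in $I_j$ and $i<_ji'$. A monochromatic quiver is obtained from such an ordered graph by orienting each edge from its larger vertex to its smaller vertex. A colored quiver is a quiver $\Upsilon$ with vertex set $I$, a finite set $C$ of colors and a map $\mathfrak{c}$ from arrows to $C$ such that, for each $c\in C$, the subquiver $\Upsilon_c=\mathfrak{c}^{-1}(c)$, with vertex set $I_c$, is a monochromatic quiver obtained from a complete $k_c$-partite graph ($k_c\ge1$). A monochromatic quiver is a colored quiver with $|C|=1$. Boalch algebra. For $c\in C$ and $i,j\in I_c$ in distinct parts there is exactly one arrow $v_{c,ij}:j\to i$ of color $c$ in the double $\overline\Upsilon$ (obtained by adding an opposite to each arrow of $\Upsilon$); put $v_{c,ij}=0$ if $i,j$ are in the same part. Let $\widetilde\Upsilon$ be obtained from $\overline\Upsilon$ by adding, for each $c\in C$, an arrow $w_{c,ij}:j\to i$ for all distinct $i,j\in I_c$ and a loop $\gamma_{c,i}$ at each $i\in I_c$. Paths are read from right to left. Let $1_{I_c}=\sum_{s\in I_c}e_s$, $w_{c+}=1_{I_c}+\sum_{i<j}w_{c,ij}$, $w_{c-}=1_{I_c}+\sum_{i>j}w_{c,ij}$, $\gamma_c=\sum_{i\in I_c}\gamma_{c,i}$, $v_{c+}=1_{I_c}+\sum_{i<j}v_{c,ij}$,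 $v_{c-}=1_{I_c}+\sum_{i>j}v_{c,ij}$, sums over $I_c$. Then $\mathcal{B}(\Upsilon)$ is the quotient of the universal localization of $k\widetilde\Upsilon$ inverting all $(1-1_{I_c})+\gamma_c$ (equivalently, adjoining inverses of $\gamma_{c,i}$ in $e_i(-)e_i$) by the ideal generated by the relations $v_{c-}v_{c+}=w_{c+}\gamma_cw_{c-}$, $c\in C$. Double brackets. Write $\otimes=\otimes_k$. Let $B=\bigoplus_{s\in I}k e_s$ with orthogonal idempotents $e_s$; let $A$ be an associative unital algebra with a unital morphism $B\to A$. A ($B$-linear) double bracket on $A$ is a $k$-bilinear map $\{\!\{-,-\}\!\}:A\times A\to A\otimes A$ that vanishes if an argument lies in $B$ and satisfies $\{\!\{a,b\}\!\}=-\tau_{(12)}\{\!\{b,a\}\!\}$ and $\{\!\{a,bc\}\!\}=\{\!\{a,b\}\!\}c+b\{\!\{a,c\}\!\}$, where $x(a'\otimes a'')y=xa'\otimes a''y$. Here $\tau_s(a_1\otimes\cdots\otimes a_n)=a_{s^{-1}(1)}\otimes\cdots\otimes a_{s^{-1}(n)}$. Put $\{\!\{a,b\otimes c\}\!\}_L=\{\!\{a,b\}\!\}\otimes c$ and $$\{\!\{a,b,c\}\!\}=\{\!\{a,\{\!\{b,c\}\!\}\}\!\}_L+\tau_{(123)}\{\!\{b,\{\!\{c,a\}\!\}\}\!\}_L+\tau_{(132)}\{\!\{c,\{\!\{a,b\}\!\}\}\!\}_L,$$ \begin{align*}\{\!\{a,b,c\}\!\}_{\mathrm{qP}}=\tfrac14\sum_{s\in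 I}\big(&ce_sa\otimes e_sb\otimes e_s-ce_sa\otimes e_s\otimes be_s-ce_s\otimes ae_sb\otimes e_s+ce_s\otimes ae_s\otimes be_s\\&-e_sa\otimes e_sb\otimes e_sc+e_sa\otimes e_s\otimes be_sc+e_s\otimes ae_sb\otimes e_sc-e_s\otimes ae_s\otimes be_sc\big).\end{align*} The double bracket is quasi-Poisson if $\{\!\{a,b,c\}\!\}=\{\!\{a,b,c\}\!\}_{\mathrm{qP}}$ for all $a,b,c\in A$. A multiplicative moment map is an invertible $\Phi=\sum_{s\in I}\Phi_s$, $\Phi_s\in e_sAe_s$, with $\{\!\{\Phi_s,a\}\!\}=\frac12(ae_s\otimes\Phi_s-e_s\otimes\Phi_sa+a\Phi_s\otimes e_s-\Phi_s\otimes e_sa)$ for all $a\in A$, $s\in I$. A Hamiltonian double quasi-Poisson algebra is a triple $(A,\{\!\{-,-\}\!\},\Phi)$ with $\{\!\{-,-\}\!\}$ quasi-Poisson and $\Phi$ a multiplicative moment map. *)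

(* Defs.v *)
From HB Require Import structures.
From mathcomp Require Import all_boot all_algebra.
From mathcomp Require Import boolp.

Set Implicit Arguments.
Unset Strict Implicit.
Unset Printing Implicit Defensive.

Import GRing.Theory.
Local Open Scope ring_scope.
Local Open Scope quotient_scope.

(* Associative unital algebras over k.  MathComp's algType excludes the zero
   ring, which is the Boalch algebra of the quiver without vertices; hence this
   packed class, whose instances carry the library's lmodType and pzRingType
   structures. *)
Record kalg (k : fieldType) := Kalg {
  kalg_lmod : lmodType k;
  kalg_one : kalg_lmod;
  kalg_mul : kalg_lmod -> kalg_lmod -> kalg_lmod;
  kalg_mulA : associative kalg_mul;
  kalg_mul1l : left_id kalg_one kalg_mul;
  kalg_mul1r : right_id kalg_one kalg_mul;
  kalg_mulDl : left_distributive kalg_mul +%R;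
  kalg_mulDr : right_distributive kalg_mul +%R;
  kalg_scaleAl : forall c x y, c *: kalg_mul x y = kalg_mul (c *: x) y;
  kalg_scaleAr : forall c x y, c *: kalg_mul x y = kalg_mul x (c *: y) }.

Definition ksort (k : fieldType) (A : kalg k) : Type := kalg_lmod A.
Coercion ksort : kalg >-> Sortclass.

Section KalgStructures.
Variables (k : fieldType) (A : kalg k).

HB.instance Definition _ :=
  GRing.Lmodule.copy (ksort A) (kalg_lmod A : lmodType k).
HB.instance Definition _ := GRing.Zmodule_isPzRing.Build (ksort A)
  (@kalg_mulA _ A) (@kalg_mul1l _ A) (@kalg_mul1r _ A)
  (@kalg_mulDl _ A) (@kalg_mulDr _ A).

Lemma kscaleAl (c : k) (x y : A) : c *: (x * y) = (c *: x) * y.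
Proof. exact: kalg_scaleAl. Qed.

Lemma kscaleAr (c : k) (x y : A) : c *: (x * y) = x * (c *: y).
Proof. exact: kalg_scaleAr. Qed.

End KalgStructures.

(* The free algebra k<X>: formal expressions modulo the axioms of k-algebras. *)
Section FreeAlgebra.
Variables (k : fieldType) (X : Type).

Inductive fterm :=
  | FGen of X | FZero | FOne | FAdd of fterm & fterm | FMul of fterm & fterm
  | FScale of k & fterm.

HB.instance Definition _ := gen_eqMixin fterm.
HB.instance Definition _ := gen_choiceMixin fterm.

Inductive feq : fterm -> fterm -> Prop :=
  | feq_refl x : feq x x
  | feq_sym x y : feq x y -> feq y x
  | feq_trans y x z : feq x y -> feq y z -> feq x z
  | feq_add x x' y y' : feq x x' -> feq y y' -> feq (FAdd x y) (FAdd x' y')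
  | feq_mul x x' y y' : feq x x' -> feq y y' -> feq (FMul x y) (FMul x' y')
  | feq_scale c x x' : feq x x' -> feq (FScale c x) (FScale c x')
  | feq_addA x y z : feq (FAdd x (FAdd y z)) (FAdd (FAdd x y) z)
  | feq_addC x y : feq (FAdd x y) (FAdd y x)
  | feq_add0 x : feq (FAdd FZero x) x
  | feq_addN x : feq (FAdd (FScale (-1) x) x) FZero
  | feq_scaleA c d x : feq (FScale c (FScale d x)) (FScale (c * d) x)
  | feq_scale1 x : feq (FScale 1 x) x
  | feq_scaleDr c x y : feq (FScale c (FAdd x y)) (FAdd (FScale c x) (FScale c y))
  | feq_scaleDl x c d : feq (FScale (c + d) x) (FAdd (FScale c x) (FScale d x))
  | feq_mulA x y z : feq (FMul x (FMul y z)) (FMul (FMul x y) z)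
  | feq_mul1l x : feq (FMul FOne x) x
  | feq_mul1r x : feq (FMul x FOne) x
  | feq_mulDl x y z : feq (FMul (FAdd x y) z) (FAdd (FMul x z) (FMul y z))
  | feq_mulDr x y z : feq (FMul x (FAdd y z)) (FAdd (FMul x y) (FMul x z))
  | feq_scaleAl c x y : feq (FScale c (FMul x y)) (FMul (FScale c x) y)
  | feq_scaleAr c x y : feq (FScale c (FMul x y)) (FMul x (FScale c y)).

Definition feqb x y := `[< feq x y >].

Lemma feqb_equiv : equiv_class_of feqb.
Proof.
split=> [x|x y|y x z]; first by apply/asboolP/feq_refl.
  by apply/asboolP/asboolP; apply: feq_sym.
by move=> /asboolP xy /asboolP yz; apply/asboolP; apply: feq_trans yz.
Qed.

Canonical feqb_equivRel := EquivRelPack feqb_equiv.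
Canonical feqb_encModRel := defaultEncModRel feqb.

Definition free_car := {eq_quot feqb}.
HB.instance Definition _ : EqQuotient fterm feqb free_car :=
  EqQuotient.on free_car.
HB.instance Definition _ := Choice.on free_car.

Local Notation pi := (\pi_free_car).

Lemma free_piP x y : pi x = pi y <-> feq x y.
Proof. by split=> [/eqmodP/asboolP|xy] //; apply/eqmodP/asboolP. Qed.

Lemma free_repr x : feq (repr (pi x)) x.
Proof. by apply/free_piP; rewrite reprK. Qed.

Definition free_add (x y : free_car) := pi (FAdd (repr x) (repr y)).
Definition free_mul (x y : free_car) := pi (FMul (repr x) (repr y)).
Definition free_scale c (x : free_car) := pi (FScale c (repr x)).
Definition free_opp (x : free_car) := free_scale (-1) x.

Lemma free_addE x y : free_add (pi x) (pi y) = pi (FAdd x y).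
Proof. by apply/free_piP; apply: feq_add; apply: free_repr. Qed.

Lemma free_mulE x y : free_mul (pi x) (pi y) = pi (FMul x y).
Proof. by apply/free_piP; apply: feq_mul; apply: free_repr. Qed.

Lemma free_scaleE c x : free_scale c (pi x) = pi (FScale c x).
Proof. by apply/free_piP; apply: feq_scale; apply: free_repr. Qed.

Lemma free_ind (P : free_car -> Prop) : (forall x, P (pi x)) -> forall x, P x.
Proof. by move=> Ppi x; rewrite -[x]reprK. Qed.

Local Ltac fq := do ?[elim/free_ind=> ?];
  rewrite /free_opp ?(free_addE, free_mulE, free_scaleE); apply/free_piP.

Lemma free_addA : associative free_add.
Proof. fq; exact: feq_addA. Qed.
Lemma free_addC : commutative free_add.
Proof. fq; exact: feq_addC. Qed.
Lemma free_add0 : left_id (pi FZero) free_add.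
Proof. fq; exact: feq_add0. Qed.
Lemma free_addN : left_inverse (pi FZero) free_opp free_add.
Proof. fq; exact: feq_addN. Qed.

HB.instance Definition _ := GRing.isZmodule.Build free_car
  free_addA free_addC free_add0 free_addN.

Lemma free_scaleA c d (x : free_car) :
  free_scale c (free_scale d x) = free_scale (c * d) x.
Proof. elim/free_ind: x => x; fq; exact: feq_scaleA. Qed.
Lemma free_scale1 : left_id 1 free_scale.
Proof. fq; exact: feq_scale1. Qed.
Lemma free_scaleDr : right_distributive free_scale +%R.
Proof. move=> c; rewrite /GRing.add /=; fq; exact: feq_scaleDr. Qed.
Lemma free_scaleDl (x : free_car) : {morph free_scale^~ x : c d / c + d}.
Proof.
move=> c d; rewrite [in RHS]/GRing.add /=; elim/free_ind: x => x.
by fq; apply: feq_scaleDl.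
Qed.

HB.instance Definition _ := GRing.Zmodule_isLmodule.Build k free_car
  free_scaleA free_scale1 free_scaleDr free_scaleDl.

Lemma free_mulA : associative free_mul.
Proof. fq; exact: feq_mulA. Qed.
Lemma free_mul1l : left_id (pi FOne) free_mul.
Proof. fq; exact: feq_mul1l. Qed.
Lemma free_mul1r : right_id (pi FOne) free_mul.
Proof. fq; exact: feq_mul1r. Qed.
Lemma free_mulDl : left_distributive free_mul +%R.
Proof. rewrite /GRing.add /=; fq; exact: feq_mulDl. Qed.
Lemma free_mulDr : right_distributive free_mul +%R.
Proof. rewrite /GRing.add /=; fq; exact: feq_mulDr. Qed.
Lemma free_scaleAl c (x y : free_car) :
  c *: free_mul x y = free_mul (c *: x) y.
Proof.
rewrite /GRing.scale /=; elim/free_ind: x => x; elim/free_ind: y => y.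
by fq; apply: feq_scaleAl.
Qed.
Lemma free_scaleAr c (x y : free_car) :
  c *: free_mul x y = free_mul x (c *: y).
Proof.
rewrite /GRing.scale /=; elim/free_ind: x => x; elim/free_ind: y => y.
by fq; apply: feq_scaleAr.
Qed.

Definition freeAlg : kalg k := Kalg free_mulA free_mul1l free_mul1r
  free_mulDl free_mulDr free_scaleAl free_scaleAr.

Definition fgen (x : X) : freeAlg := pi (FGen x).

End FreeAlgebra.

Arguments fgen {k X} x.

(* The quotient of A by the two-sided ideal generated by S. *)
Section QuotientAlgebra.
Variables (k : fieldType) (A : kalg k) (S : A -> Prop).

Inductive ideal_gen : A -> Prop :=
  | ideal_in x : S x -> ideal_gen x
  | ideal_0 : ideal_gen 0
  | ideal_add x y : ideal_gen x -> ideal_gen y -> ideal_gen (x + y)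
  | ideal_mul a x b : ideal_gen x -> ideal_gen (a * x * b).

Lemma ideal_mull a x : ideal_gen x -> ideal_gen (a * x).
Proof. by rewrite -[a * x]mulr1; apply: ideal_mul. Qed.

Lemma ideal_mulr a x : ideal_gen x -> ideal_gen (x * a).
Proof. by rewrite -[x * a]mul1r mulrA; apply: ideal_mul. Qed.

Lemma ideal_scale c x : ideal_gen x -> ideal_gen (c *: x).
Proof. by rewrite -[x]mul1r kscaleAl mul1r; apply: ideal_mull. Qed.

Lemma ideal_opp x : ideal_gen x -> ideal_gen (- x).
Proof. by rewrite -scaleN1r; apply: ideal_scale. Qed.

Definition ideqb (x y : A) := `[< ideal_gen (x - y) >].

Lemma ideqb_equiv : equiv_class_of ideqb.
Proof.
have sym x y : ideqb x y -> ideqb y x.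
  by move=> /asboolP /ideal_opp; rewrite opprB => ?; apply/asboolP.
split=> [x|x y|y x z].
- by apply/asboolP; rewrite subrr; apply: ideal_0.
- by apply/idP/idP; apply: sym.
move=> /asboolP xy /asboolP yz; apply/asboolP.
by rewrite -[x](subrK y) -addrA; apply: ideal_add.
Qed.

Canonical ideqb_equivRel := EquivRelPack ideqb_equiv.
Canonical ideqb_encModRel := defaultEncModRel ideqb.

Definition quot_car := {eq_quot ideqb}.
HB.instance Definition _ : EqQuotient A ideqb quot_car := EqQuotient.on quot_car.
HB.instance Definition _ := Choice.on quot_car.

Local Notation pi := (\pi_quot_car).

Lemma quot_piP (x y : A) : pi x = pi y <-> ideal_gen (x - y).
Proof. by split=> [/eqmodP/asboolP|xy] //; apply/eqmodP/asboolP. Qed.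

Lemma quot_repr (x : A) : ideal_gen (repr (pi x) - x).
Proof. by apply/quot_piP; rewrite reprK. Qed.

Definition quot_add (x y : quot_car) := pi (repr x + repr y).
Definition quot_mul (x y : quot_car) := pi (repr x * repr y).
Definition quot_scale (c : k) (x : quot_car) := pi (c *: repr x).
Definition quot_opp (x : quot_car) := pi (- repr x).

Lemma quot_addE x y : quot_add (pi x) (pi y) = pi (x + y).
Proof. by apply/quot_piP; rewrite opprD addrACA; apply: ideal_add; apply: quot_repr. Qed.

Lemma quot_mulE x y : quot_mul (pi x) (pi y) = pi (x * y).
Proof.
apply/quot_piP.
have -> : repr (pi x) * repr (pi y) - x * y =
    (repr (pi x) - x) * repr (pi y) + x * (repr (pi y) - y).
  by rewrite mulrBl mulrBr addrA subrK.
by apply: ideal_add; [apply: ideal_mulr | apply: ideal_mull]; apply: quot_repr.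
Qed.

Lemma quot_scaleE c x : quot_scale c (pi x) = pi (c *: x).
Proof. by apply/quot_piP; rewrite -scalerBr; apply: ideal_scale; apply: quot_repr. Qed.

Lemma quot_oppE x : quot_opp (pi x) = pi (- x).
Proof. by apply/quot_piP; rewrite -opprD; apply: ideal_opp; apply: quot_repr. Qed.

Lemma quot_ind (P : quot_car -> Prop) : (forall x, P (pi x)) -> forall x, P x.
Proof. by move=> Ppi x; rewrite -[x]reprK. Qed.

Local Ltac qq := do ?[elim/quot_ind=> ?];
  rewrite ?(quot_addE, quot_mulE, quot_scaleE, quot_oppE); congr (pi _).

Lemma quot_addA : associative quot_add. Proof. qq; exact: addrA. Qed.
Lemma quot_addC : commutative quot_add. Proof. qq; exact: addrC. Qed.
Lemma quot_add0 : left_id (pi 0) quot_add. Proof. qq; exact: add0r. Qed.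
Lemma quot_addN : left_inverse (pi 0) quot_opp quot_add.
Proof. qq; exact: addNr. Qed.

HB.instance Definition _ := GRing.isZmodule.Build quot_car
  quot_addA quot_addC quot_add0 quot_addN.

Lemma quot_scaleA c d (x : quot_car) :
  quot_scale c (quot_scale d x) = quot_scale (c * d) x.
Proof. elim/quot_ind: x => x; qq; exact: scalerA. Qed.
Lemma quot_scale1 : left_id 1 quot_scale.
Proof. qq; exact: scale1r. Qed.
Lemma quot_scaleDr : right_distributive quot_scale +%R.
Proof. move=> c; rewrite /GRing.add /=; qq; exact: scalerDr. Qed.
Lemma quot_scaleDl (x : quot_car) : {morph quot_scale^~ x : c d / c + d}.
Proof.
move=> c d; rewrite [in RHS]/GRing.add /=; elim/quot_ind: x => x.
by qq; apply: scalerDl.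
Qed.

HB.instance Definition _ := GRing.Zmodule_isLmodule.Build k quot_car
  quot_scaleA quot_scale1 quot_scaleDr quot_scaleDl.

Lemma quot_mulA : associative quot_mul. Proof. qq; exact: mulrA. Qed.
Lemma quot_mul1l : left_id (pi 1) quot_mul. Proof. qq; exact: mul1r. Qed.
Lemma quot_mul1r : right_id (pi 1) quot_mul. Proof. qq; exact: mulr1. Qed.
Lemma quot_mulDl : left_distributive quot_mul +%R.
Proof. rewrite /GRing.add /=; qq; exact: mulrDl. Qed.
Lemma quot_mulDr : right_distributive quot_mul +%R.
Proof. rewrite /GRing.add /=; qq; exact: mulrDr. Qed.
Lemma quot_scaleAl c (x y : quot_car) :
  c *: quot_mul x y = quot_mul (c *: x) y.
Proof.
rewrite /GRing.scale /=; elim/quot_ind: x => x; elim/quot_ind: y => y.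
by qq; apply: kscaleAl.
Qed.
Lemma quot_scaleAr c (x y : quot_car) :
  c *: quot_mul x y = quot_mul x (c *: y).
Proof.
rewrite /GRing.scale /=; elim/quot_ind: x => x; elim/quot_ind: y => y.
by qq; apply: kscaleAr.
Qed.

Definition quotAlg : kalg k := Kalg quot_mulA quot_mul1l quot_mul1r
  quot_mulDl quot_mulDr quot_scaleAl quot_scaleAr.

Definition qproj (x : A) : quotAlg := pi x.

Lemma qproj_linear : linear qproj.
Proof. by move=> c x y; rewrite -[qproj (_ + _)]quot_addE -quot_scaleE. Qed.

Lemma qprojM (x y : A) : qproj (x * y) = qproj x * qproj y.
Proof. by rewrite -[qproj (x * y)]quot_mulE. Qed.

Lemma qproj1 : qproj 1 = 1. Proof. by []. Qed.

End QuotientAlgebra.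

Arguments qproj {k A} S x.

(* U (x)_k V: formal expressions in pure tensors modulo the axioms of
   k-modules and bilinearity of the pure tensor. *)
Section Tensor.
Variables (k : fieldType) (U V : lmodType k).

Inductive tterm :=
  | TPure of U & V | TZero | TAdd of tterm & tterm | TScale of k & tterm.

HB.instance Definition _ := gen_eqMixin tterm.
HB.instance Definition _ := gen_choiceMixin tterm.

Inductive teq : tterm -> tterm -> Prop :=
  | teq_refl x : teq x x
  | teq_sym x y : teq x y -> teq y x
  | teq_trans y x z : teq x y -> teq y z -> teq x z
  | teq_add x x' y y' : teq x x' -> teq y y' -> teq (TAdd x y) (TAdd x' y')
  | teq_scale c x x' : teq x x' -> teq (TScale c x) (TScale c x')
  | teq_addA x y z : teq (TAdd x (TAdd y z)) (TAdd (TAdd x y) z)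
  | teq_addC x y : teq (TAdd x y) (TAdd y x)
  | teq_add0 x : teq (TAdd TZero x) x
  | teq_addN x : teq (TAdd (TScale (-1) x) x) TZero
  | teq_scaleA c d x : teq (TScale c (TScale d x)) (TScale (c * d) x)
  | teq_scale1 x : teq (TScale 1 x) x
  | teq_scaleDr c x y : teq (TScale c (TAdd x y)) (TAdd (TScale c x) (TScale c y))
  | teq_scaleDl x c d : teq (TScale (c + d) x) (TAdd (TScale c x) (TScale d x))
  | teq_pureDl u u' v : teq (TPure (u + u') v) (TAdd (TPure u v) (TPure u' v))
  | teq_pureDr u v v' : teq (TPure u (v + v')) (TAdd (TPure u v) (TPure u v'))
  | teq_pureZl c u v : teq (TPure (c *: u) v) (TScale c (TPure u v))
  | teq_pureZr c u v : teq (TPure u (c *: v)) (TScale c (TPure u v)).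

Definition teqb x y := `[< teq x y >].

Lemma teqb_equiv : equiv_class_of teqb.
Proof.
split=> [x|x y|y x z]; first by apply/asboolP/teq_refl.
  by apply/asboolP/asboolP; apply: teq_sym.
by move=> /asboolP xy /asboolP yz; apply/asboolP; apply: teq_trans yz.
Qed.

Canonical teqb_equivRel := EquivRelPack teqb_equiv.
Canonical teqb_encModRel := defaultEncModRel teqb.

Definition tensor := {eq_quot teqb}.
HB.instance Definition _ : EqQuotient tterm teqb tensor := EqQuotient.on tensor.
HB.instance Definition _ := Choice.on tensor.

Local Notation pi := (\pi_tensor).

Lemma tensor_piP x y : pi x = pi y <-> teq x y.
Proof. by split=> [/eqmodP/asboolP|xy] //; apply/eqmodP/asboolP. Qed.

Lemma tensor_repr x : teq (repr (pi x)) x.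
Proof. by apply/tensor_piP; rewrite reprK. Qed.

Definition tensor_add (x y : tensor) := pi (TAdd (repr x) (repr y)).
Definition tensor_scale c (x : tensor) := pi (TScale c (repr x)).
Definition tensor_opp (x : tensor) := tensor_scale (-1) x.

Lemma tensor_addE x y : tensor_add (pi x) (pi y) = pi (TAdd x y).
Proof. by apply/tensor_piP; apply: teq_add; apply: tensor_repr. Qed.

Lemma tensor_scaleE c x : tensor_scale c (pi x) = pi (TScale c x).
Proof. by apply/tensor_piP; apply: teq_scale; apply: tensor_repr. Qed.

Lemma tensor_pi_ind (P : tensor -> Prop) :
  (forall x, P (pi x)) -> forall x, P x.
Proof. by move=> Ppi x; rewrite -[x]reprK. Qed.

Local Ltac tq := do ?[elim/tensor_pi_ind=> ?];
  rewrite /tensor_opp ?(tensor_addE, tensor_scaleE); apply/tensor_piP.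

Lemma tensor_addA : associative tensor_add.
Proof. tq; exact: teq_addA. Qed.
Lemma tensor_addC : commutative tensor_add.
Proof. tq; exact: teq_addC. Qed.
Lemma tensor_add0 : left_id (pi TZero) tensor_add.
Proof. tq; exact: teq_add0. Qed.
Lemma tensor_addN : left_inverse (pi TZero) tensor_opp tensor_add.
Proof. tq; exact: teq_addN. Qed.

HB.instance Definition _ := GRing.isZmodule.Build tensor
  tensor_addA tensor_addC tensor_add0 tensor_addN.

Lemma tensor_scaleA c d (x : tensor) :
  tensor_scale c (tensor_scale d x) = tensor_scale (c * d) x.
Proof. elim/tensor_pi_ind: x => x; tq; exact: teq_scaleA. Qed.
Lemma tensor_scale1 : left_id 1 tensor_scale.
Proof. tq; exact: teq_scale1. Qed.
Lemma tensor_scaleDr : right_distributive tensor_scale +%R.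
Proof. move=> c; rewrite /GRing.add /=; tq; exact: teq_scaleDr. Qed.
Lemma tensor_scaleDl (x : tensor) : {morph tensor_scale^~ x : c d / c + d}.
Proof.
move=> c d; rewrite [in RHS]/GRing.add /=; elim/tensor_pi_ind: x => x.
by tq; apply: teq_scaleDl.
Qed.

HB.instance Definition _ := GRing.Zmodule_isLmodule.Build k tensor
  tensor_scaleA tensor_scale1 tensor_scaleDr tensor_scaleDl.

Definition pure (u : U) (v : V) : tensor := pi (TPure u v).

Lemma pure_linearl v : linear (pure^~ v).
Proof.
move=> c u u'; rewrite {2}/GRing.add {2}/GRing.scale /=.
rewrite tensor_scaleE tensor_addE; apply/tensor_piP.
apply: teq_trans (teq_pureDl _ _ _) _.
by apply: teq_add (teq_refl _); apply: teq_pureZl.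
Qed.

Lemma pure_linearr u : linear (pure u).
Proof.
move=> c v v'; rewrite {2}/GRing.add {2}/GRing.scale /=.
rewrite tensor_scaleE tensor_addE; apply/tensor_piP.
apply: teq_trans (teq_pureDr _ _ _) _.
by apply: teq_add (teq_refl _); apply: teq_pureZr.
Qed.

(* The linear extension of (u, v) |-> f u v to the tensor product, computed on
   a representative.  By tlift_pure, tlift_linear and tlift_unique it is the
   linear map given by the universal property whenever f is bilinear. *)
Section Lift.
Variables (W : lmodType k) (f : U -> V -> W).

Fixpoint teval (t : tterm) : W :=
  match t with
  | TPure u v => f u v
  | TZero => 0
  | TAdd x y => teval x + teval y
  | TScale c x => c *: teval x
  end.

Definition tlift (t : tensor) : W := teval (repr t).

Hypotheses (fl : forall v, linear (f^~ v)) (fr : forall u, linear (f u)).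

Lemma teval_eq x y : teq x y -> teval x = teval y.
Proof.
have f0l v : f 0 v = 0.
  by have := fl v (-1) 0 0; rewrite scaler0 addr0 scaleN1r addNr.
have f0r u : f u 0 = 0.
  by have := fr u (-1) 0 0; rewrite scaler0 addr0 scaleN1r addNr.
elim=> {x y} //=.
- by move=> y x z _ -> _ ->.
- by move=> x x' y y' _ -> _ ->.
- by move=> c x x' _ ->.
- by move=> *; rewrite addrA.
- by move=> *; rewrite addrC.
- by move=> *; rewrite add0r.
- by move=> *; rewrite scaleN1r addNr.
- by move=> *; rewrite scalerA.
- by move=> *; rewrite scale1r.
- by move=> *; rewrite scalerDr.
- by move=> *; rewrite scalerDl.
- by move=> u u' v; have := fl v 1 u u'; rewrite !scale1r.
- by move=> u v v'; have := fr u 1 v v'; rewrite !scale1r.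
- by move=> c u v; have := fl v c u 0; rewrite f0l !addr0.
- by move=> c u v; have := fr u c v 0; rewrite f0r !addr0.
Qed.

Lemma tlift_pi x : tlift (pi x) = teval x.
Proof. by apply: teval_eq; apply: tensor_repr. Qed.

Lemma tlift_pure u v : tlift (pure u v) = f u v.
Proof. exact: tlift_pi. Qed.

Lemma tlift_linear : linear tlift.
Proof.
move=> c; elim/tensor_pi_ind=> x; elim/tensor_pi_ind=> y.
rewrite {1}/GRing.add {1}/GRing.scale /=.
by rewrite tensor_scaleE tensor_addE !tlift_pi.
Qed.

End Lift.

Lemma tensor_ind (P : tensor -> Prop) :
  (forall u v, P (pure u v)) -> P 0 ->
  (forall x y, P x -> P y -> P (x + y)) -> (forall c x, P x -> P (c *: x)) ->
  forall x, P x.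
Proof.
move=> Pp P0 PD PZ; elim/tensor_pi_ind.
elim=> [u v||x Px y Py|c x Px]; [exact: Pp|exact: P0| |].
- by rewrite -tensor_addE; apply: PD.
- by rewrite -tensor_scaleE; apply: PZ.
Qed.

Lemma tlift_unique (W : lmodType k) (f : U -> V -> W) (g : tensor -> W) :
  (forall v, linear (f^~ v)) -> (forall u, linear (f u)) ->
  linear g -> (forall u v, g (pure u v) = f u v) -> g =1 tlift f.
Proof.
move=> fl fr gl gp.
have fl' := tlift_linear fl fr.
have g0 : g 0 = 0 by have := gl (-1) 0 0; rewrite scaler0 addr0 scaleN1r addNr.
have f0 : tlift f 0 = 0.
  by have := fl' (-1) 0 0; rewrite scaler0 addr0 scaleN1r addNr.
elim/tensor_ind=> [u v||x y ex ey|c x ex].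
- by rewrite gp tlift_pure.
- by rewrite g0 f0.
- by have := gl 1 x y; have := fl' 1 x y; rewrite !scale1r ex ey => -> ->.
- by have := gl c x 0; have := fl' c x 0; rewrite !addr0 g0 f0 !addr0 ex => -> ->.
Qed.

End Tensor.

Section DoubleBrackets.
Variables (k : fieldType) (A : kalg k).

Definition tens2 : lmodType k := tensor (ksort A) (ksort A).
Definition tens3 : lmodType k := tensor tens2 (ksort A).

Definition t2 (a b : A) : tens2 := pure a b.
Definition t3 (a b c : A) : tens3 := pure (t2 a b) c.

Definition tens2_lift (W : lmodType k) (f : A -> A -> W) : tens2 -> W := tlift f.
Definition tens3_lift (W : lmodType k) (f : A -> A -> A -> W) : tens3 -> W :=
  tlift (fun (t : tens2) (z : A) => tens2_lift (fun x y => f x y z) t).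

(* tau_s (a_1 (x) ... (x) a_n) has factors a_{s^-1(1)}, ..., a_{s^-1(n)}. *)
Definition tau12 : tens2 -> tens2 := tens2_lift (fun x y => t2 y x).
Definition tau123 : tens3 -> tens3 := tens3_lift (fun x y z => t3 z x y).
Definition tau132 : tens3 -> tens3 := tens3_lift (fun x y z => t3 y z x).

(* x (a' (x) a'') y = x a' (x) a'' y *)
Definition outer (x : A) (t : tens2) (y : A) : tens2 :=
  tens2_lift (fun a b => t2 (x * a) (b * y)) t.

Variables (I : finType) (e : I -> A).

(* e describes a unital morphism B -> A, B = (+)_s k e_s. *)
Definition is_idempotent_family :=
  (forall s t, e s * e t = if s == t then e s else 0) /\ \sum_s e s = 1.

Definition base_elt (x : I -> k) : A := \sum_s x s *: e s.

Definition is_double_bracket (br : A -> A -> tens2) : Prop :=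
  [/\ (forall b, linear (br^~ b)) /\ (forall a, linear (br a)),
      forall x a, br (base_elt x) a = 0 /\ br a (base_elt x) = 0,
      forall a b, br a b = - tau12 (br b a) &
      forall a b c, br a (b * c) = outer 1 (br a b) c + outer b (br a c) 1].

(* {{a, b (x) c}}_L = {{a, b}} (x) c *)
Definition bracketL (br : A -> A -> tens2) (a : A) : tens2 -> tens3 :=
  tens2_lift (fun b c => pure (br a b) c : tens3).

Definition triple_bracket (br : A -> A -> tens2) (a b c : A) : tens3 :=
  bracketL br a (br b c) + tau123 (bracketL br b (br c a))
  + tau132 (bracketL br c (br a b)).

Definition qP_bracket (a b c : A) : tens3 :=
  (4%:R : k)^-1 *: \sum_(s : I)
    (t3 (c * e s * a) (e s * b) (e s) - t3 (c * e s * a) (e s) (b * e s)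
     - t3 (c * e s) (a * e s * b) (e s) + t3 (c * e s) (a * e s) (b * e s)
     - t3 (e s * a) (e s * b) (e s * c) + t3 (e s * a) (e s) (b * e s * c)
     + t3 (e s) (a * e s * b) (e s * c) - t3 (e s) (a * e s) (b * e s * c)).

Definition is_quasi_poisson (br : A -> A -> tens2) : Prop :=
  forall a b c, triple_bracket br a b c = qP_bracket a b c.

Definition is_moment_map (br : A -> A -> tens2) (Phi : I -> A) : Prop :=
  [/\ exists Psi : A, Psi * (\sum_s Phi s) = 1 /\ (\sum_s Phi s) * Psi = 1,
      forall s, exists x, Phi s = e s * x * e s &
      forall a s, br (Phi s) a =
        (2%:R : k)^-1 *: (t2 (a * e s) (Phi s) - t2 (e s) (Phi s * a)
                          + t2 (a * Phi s) (e s) - t2 (Phi s) (e s * a))].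

Definition is_hamiltonian (br : A -> A -> tens2) (Phi : I -> A) : Prop :=
  [/\ is_idempotent_family, is_double_bracket br, is_quasi_poisson br
    & is_moment_map br Phi].

Lemma tens2_lift_t2 (W : lmodType k) (f : A -> A -> W) a b :
  (forall y, linear (f^~ y)) -> (forall x, linear (f x)) ->
  tens2_lift f (t2 a b) = f a b.
Proof. by move=> fl fr; rewrite /tens2_lift /t2 tlift_pure. Qed.

Lemma tens2_lift_linear (W : lmodType k) (f : A -> A -> W) :
  (forall y, linear (f^~ y)) -> (forall x, linear (f x)) ->
  linear (tens2_lift f).
Proof. exact: tlift_linear. Qed.

Lemma tens3_lift_t3 (W : lmodType k) (f : A -> A -> A -> W) a b c :
  (forall y z, linear (fun x => f x y z)) ->
  (forall x z, linear (fun y => f x y z)) -> (forall x y, linear (f x y)) ->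
  tens3_lift f (t3 a b c) = f a b c.
Proof.
move=> f1 f2 f3; have lin z : linear (tens2_lift (fun x y => f x y z)).
  exact: tens2_lift_linear.
rewrite /tens3_lift /t3 tlift_pure //; first exact: tens2_lift_t2.
have lin0 w : tens2_lift (fun x y => f x y w) 0 = 0.
  by have := lin w (-1) 0 0; rewrite scaler0 addr0 scaleN1r addNr.
move=> t d z z'; elim/tensor_ind: t => [x y||t u et eu|d' t et].
- by rewrite !tens2_lift_t2 // f3.
- by rewrite !lin0 scaler0 addr0.
- have linD w : tens2_lift (fun x y => f x y w) (t + u) =
      tens2_lift (fun x y => f x y w) t + tens2_lift (fun x y => f x y w) u.
    by have := lin w 1 t u; rewrite !scale1r.
  by rewrite !linD et eu scalerDr addrACA.
- have linZ w : tens2_lift (fun x y => f x y w) (d' *: t) =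
      d' *: tens2_lift (fun x y => f x y w) t.
    by have := lin w d' t 0; rewrite lin0 !addr0.
  by rewrite !linZ et scalerDr !scalerA mulrC.
Qed.

Lemma t2_linearl b : linear (t2^~ b). Proof. exact: pure_linearl. Qed.
Lemma t2_linearr a : linear (t2 a). Proof. exact: pure_linearr. Qed.

Lemma t3_linear1 b c : linear (fun a => t3 a b c).
Proof. by move=> d x y; rewrite /t3 t2_linearl pure_linearl. Qed.
Lemma t3_linear2 a c : linear (fun b => t3 a b c).
Proof. by move=> d x y; rewrite /t3 t2_linearr pure_linearl. Qed.
Lemma t3_linear3 a b : linear (t3 a b). Proof. exact: pure_linearr. Qed.

Lemma tau12_t2 a b : tau12 (t2 a b) = t2 b a.
Proof.
rewrite /tau12 tens2_lift_t2 // => x; [exact: t2_linearr|exact: t2_linearl].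
Qed.

Lemma tau123_t3 a b c : tau123 (t3 a b c) = t3 c a b.
Proof.
rewrite /tau123 tens3_lift_t3 // => x y.
- exact: t3_linear2.
- exact: t3_linear3.
- exact: t3_linear1.
Qed.

Lemma tau132_t3 a b c : tau132 (t3 a b c) = t3 b c a.
Proof.
rewrite /tau132 tens3_lift_t3 // => x y.
- exact: t3_linear3.
- exact: t3_linear1.
- exact: t3_linear2.
Qed.

Lemma outer_t2 x a b y : outer x (t2 a b) y = t2 (x * a) (b * y).
Proof.
rewrite /outer tens2_lift_t2 // => z c u v.
- by rewrite mulrDr -kscaleAr t2_linearl.
- by rewrite mulrDl -kscaleAl t2_linearr.
Qed.

Lemma bracketL_t2 br a b c : (forall a, linear (br a)) ->
  bracketL br a (t2 b c) = pure (br a b) c.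
Proof.
move=> brl; rewrite /bracketL tens2_lift_t2 // => z d u v.
- by rewrite brl pure_linearl.
- by rewrite pure_linearr.
Qed.

End DoubleBrackets.

(* The universal localization of A inverting the elements x j, presented by
   the elements of A (with the relations holding in A) and formal inverses. *)
Section UniversalLocalization.
Variables (k : fieldType) (A : kalg k) (J : Type) (x : J -> A).

Let F := freeAlg k (A + J).
Let elt (a : A) : F := fgen (inl a).
Let inv (j : J) : F := fgen (inr j).

Inductive uloc_rel : F -> Prop :=
  | uloc_linear c a b : uloc_rel (elt (c *: a + b) - (c *: elt a + elt b))
  | uloc_mul a b : uloc_rel (elt (a * b) - elt a * elt b)
  | uloc_one : uloc_rel (elt 1 - 1)
  | uloc_invl j : uloc_rel (inv j * elt (x j) - 1)
  | uloc_invr j : uloc_rel (elt (x j) * inv j - 1).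

Definition uloc : kalg k := quotAlg uloc_rel.
Definition uloc_map (a : A) : uloc := qproj uloc_rel (elt a).

End UniversalLocalization.

Record quiver (I : finType) := Quiver {
  arrow : finType;
  src : arrow -> I;
  tgt : arrow -> I }.

Definition double_quiver (I : finType) (Q : quiver I) : quiver I :=
  @Quiver I (arrow Q + arrow Q)%type
    (fun a => match a with inl b => src b | inr b => tgt b end)
    (fun a => match a with inl b => tgt b | inr b => src b end).

(* Paths are composed from right to left. *)
Section PathAlgebra.
Variables (k : fieldType) (I : finType) (Q : quiver I).

Let F := freeAlg k (I + arrow Q).
Let ve (s : I) : F := fgen (inl s).
Let ar (a : arrow Q) : F := fgen (inr a).

Inductive path_rel : F -> Prop :=
  | path_orth s t : path_rel (ve s * ve t - (if s == t then ve s else 0))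
  | path_one : path_rel (\sum_s ve s - 1)
  | path_tgt a : path_rel (ve (tgt a) * ar a - ar a)
  | path_src a : path_rel (ar a * ve (src a) - ar a).

Definition path_algebra : kalg k := quotAlg path_rel.
Definition path_vertex (s : I) : path_algebra := qproj path_rel (ve s).
Definition path_arrow (a : arrow Q) : path_algebra := qproj path_rel (ar a).

End PathAlgebra.

(* A complete multipartite graph with ordered parts and ordered vertices in
   each part, its vertex set being a subset of I.  The functions mp_part and
   mp_ord are only meaningful on mp_vert. *)
Record multipartite (I : finType) := Multipartite {
  mp_vert : {set I};
  mp_size : nat;
  mp_part : I -> nat;
  mp_ord : rel I;
  mp_size_gt0 : (0 < mp_size)%N;
  mp_part_lt : forall i, i \in mp_vert -> (mp_part i < mp_size)%N;
  mp_part_nonempty :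
    forall p, (p < mp_size)%N -> exists2 i, i \in mp_vert & mp_part i = p;
  mp_ord_irr : {in mp_vert, irreflexive mp_ord};
  mp_ord_trans : {in mp_vert & &, forall i j l, mp_part j = mp_part i ->
    mp_part l = mp_part i -> mp_ord i j -> mp_ord j l -> mp_ord i l};
  mp_ord_total : {in mp_vert &, forall i j, mp_part i = mp_part j ->
    i != j -> mp_ord i j || mp_ord j i} }.

Definition mp_lt (I : finType) (G : multipartite I) (i j : I) : bool :=
  (mp_part G i < mp_part G j)%N
  || (mp_part G i == mp_part G j) && mp_ord G i j.

Definition mp_edge (I : finType) (G : multipartite I) (i j : I) : bool :=
  [&& i \in mp_vert G, j \in mp_vert G & mp_part G i != mp_part G j].

(* The last field: there is one arrow j -> i of color c if i < j are joined by
   an edge of the graph of color c, and there are no other arrows. *)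
Record colored_quiver (I C : finType) := ColoredQuiver {
  cq_quiver :> quiver I;
  cq_color : arrow cq_quiver -> C;
  cq_layer : C -> multipartite I;
  cq_arrows : forall c i j,
    #|[set a | [&& cq_color a == c, src a == j & tgt a == i]]| =
    (mp_edge (cq_layer c) i j && mp_lt (cq_layer c) i j) :> nat }.

Definition cq_vert (I C : finType) (Q : colored_quiver I C) (c : C) : {set I} :=
  mp_vert (cq_layer Q c).

Definition cq_lt (I C : finType) (Q : colored_quiver I C) (c : C) : rel I :=
  mp_lt (cq_layer Q c).

Definition monochromatic (I C : finType) (Q : colored_quiver I C) : Prop :=
  #|C| = 1%N /\ forall c, cq_vert Q c = [set: I].

(* ord s lists, in increasing order, the colors c with s \in I_c. *)
Definition color_ordering (I C : finType) (Q : colored_quiver I C)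
    (ord : I -> seq C) : Prop :=
  forall s, uniq (ord s) /\ forall c, (c \in ord s) = (s \in cq_vert Q c).

Section BoalchAlgebra.
Variables (k : fieldType) (I C : finType) (Q : colored_quiver I C).

Definition w_index :=
  {x : C * I * I | [&& x.1.2 \in cq_vert Q x.1.1, x.2 \in cq_vert Q x.1.1
                     & x.1.2 != x.2]}.
Definition gamma_index := {x : C * I | x.2 \in cq_vert Q x.1}.

(* The arrow of w_index over (c, i, j) is w_{c,ij} : j -> i. *)
Definition tilde_quiver : quiver I :=
  @Quiver I (arrow (double_quiver Q) + (w_index + gamma_index))%type
    (fun a => match a with
              | inl b => src b
              | inr (inl x) => (val x).2
              | inr (inr x) => (val x).2 end)
    (fun a => match a with
              | inl b => tgt b
              | inr (inl x) => (val x).1.2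
              | inr (inr x) => (val x).2 end).

Definition tilde_algebra : kalg k := path_algebra k tilde_quiver.

Definition double_color (a : arrow (double_quiver Q)) : C :=
  match a with inl b => cq_color b | inr b => cq_color b end.

Definition tilde_arrow (a : arrow tilde_quiver) : tilde_algebra := path_arrow k a.

(* Each of the three sums below has at most one term: it is the arrow if there
   is one, and 0 otherwise. *)
Definition v_arrow (c : C) (i j : I) : tilde_algebra :=
  \sum_(a : arrow (double_quiver Q) |
        [&& double_color a == c, src a == j & tgt a == i]) tilde_arrow (inl a).
Definition w_arrow (c : C) (i j : I) : tilde_algebra :=
  \sum_(x : w_index | val x == (c, i, j)) tilde_arrow (inr (inl x)).
Definition gamma_arrow (c : C) (i : I) : tilde_algebra :=
  \sum_(x : gamma_index | val x == (c, i)) tilde_arrow (inr (inr x)).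

Definition color_one (c : C) : tilde_algebra :=
  \sum_(s in cq_vert Q c) path_vertex k tilde_quiver s.
Definition w_plus (c : C) : tilde_algebra :=
  color_one c + \sum_(i in cq_vert Q c) \sum_(j in cq_vert Q c | cq_lt Q c i j)
                  w_arrow c i j.
Definition w_minus (c : C) : tilde_algebra :=
  color_one c + \sum_(i in cq_vert Q c) \sum_(j in cq_vert Q c | cq_lt Q c j i)
                  w_arrow c i j.
Definition v_plus (c : C) : tilde_algebra :=
  color_one c + \sum_(i in cq_vert Q c) \sum_(j in cq_vert Q c | cq_lt Q c i j)
                  v_arrow c i j.
Definition v_minus (c : C) : tilde_algebra :=
  color_one c + \sum_(i in cq_vert Q c) \sum_(j in cq_vert Q c | cq_lt Q c j i)
                  v_arrow c i j.
Definition gamma_sum (c : C) : tilde_algebra :=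
  \sum_(i in cq_vert Q c) gamma_arrow c i.

Definition to_invert (c : C) : tilde_algebra := (1 - color_one c) + gamma_sum c.

Definition tilde_localization : kalg k := uloc to_invert.

Definition boalch_rel (y : tilde_localization) : Prop :=
  exists c, y = uloc_map to_invert (v_minus c * v_plus c)
              - uloc_map to_invert (w_plus c * gamma_sum c * w_minus c).

Definition boalch : kalg k := quotAlg boalch_rel.

Definition to_boalch (x : tilde_algebra) : boalch :=
  qproj boalch_rel (uloc_map to_invert x).

Definition boalch_e (s : I) : boalch := to_boalch (path_vertex k tilde_quiver s).
Definition boalch_gamma (c : C) (s : I) : boalch := to_boalch (gamma_arrow c s).

(* The product is taken in e_s B e_s, so the empty product is e_s. *)
Definition boalch_phi (ord : I -> seq C) (s : I) : boalch :=
  \big[*%R/boalch_e s]_(c <- ord s) boalch_gamma c s.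

Definition boalch_hamiltonian (ord : I -> seq C) : Prop :=
  exists br : boalch -> boalch -> tens2 boalch,
    is_hamiltonian boalch_e br (boalch_phi ord).

End BoalchAlgebra.

(* Main.v *)
From HB Require Import structures.
Require Import Defs.
From mathcomp Require Import all_boot all_algebra.
From mathcomp Require Import boolp ring.

Set Implicit Arguments.
Unset Strict Implicit.
Unset Printing Implicit Defensive.

Import GRing.Theory.
Local Open Scope ring_scope.
Local Open Scope quotient_scope.

(** The Boalch algebra A of a colored quiver is a coproduct.  For a color c, the
    c-colored part of the quiver is a monochromatic quiver on I_c; let A_c be its
    Boalch algebra.  Every arrow that generates A carries exactly one color and every
    relation and every inverted element of A involves exactly one color, so A is
    the coproduct of the A_c over the base B = sum_s k e_s (boalch_base_coproduct).
    The maps A_c -> A send 1 to sum_(s in I_c) e_s; this is why universal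
    properties are stated for algebra maps that need not preserve the unit.

    It remains to equip a coproduct of Hamiltonian double quasi-Poisson algebras
    A_c with such a structure (coproduct_hamiltonian).  This is Van den Bergh's
    fusion, done for all colors at once.  On a pair of elements of one A_c the
    bracket is the given one; for a in A_c and b in A_d with c <> d it is
      1/2 sum_s eps_cd(s) (b e_s ⊗ a e_s - e_s ⊗ a e_s b
                           - b e_s a ⊗ e_s + e_s a ⊗ e_s b),
    where eps_cd(s) is -1 if c precedes d at s and 1 otherwise.  These formulas
    are derivations in both arguments.  A derivation A -> A ⊗ A is an algebra map
    to a square-zero extension of A, so the universal property of the coproduct
    extends them to a double bracket on A (bracket_extension).

    Both the triple bracket and the quasi-Poisson expression are cyclically
    invariant and are derivations in their last argument, so they are compared
    only on elements of the A_c (quasi_poisson_generators).  If the three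
    elements have one color, this is the hypothesis on A_c.  Otherwise the terms
    quadratic in the signs collect, by a single identity (third_second_fus), to
    1/4 sum_s (sign polynomial at s) times the quasi-Poisson term at s.  The sign
    polynomial is eps_cd^2 = 1 when two colors occur, and, when there are three,
      eps_df eps_cf + eps_fc eps_dc + eps_cd eps_fd = 1,
    which is how three signs of a total order are related.

    For the moment map, the bracket of a product of gamma_c(s) over colors
    preceding (or following) d with an element of A_d is a single fusion term, as
    a fusion term is a derivation in each argument.  The product over all colors
    at s is a product of the colors before d, of d itself, and of those after d;
    the three contributions telescope (moment_term_sandwich). *)

(** * Linear identities as ring identities *)

(** The ring k + M with M M = 0.  It contains M, so that an identity between
    linear combinations in M becomes a polynomial identity in a commutative ring,
    which the ring tactic decides. *)
Section TrivialExtension.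
Variables (k : fieldType) (M : lmodType k).

Definition triv_ext := (k * M)%type.
HB.instance Definition _ := GRing.Zmodule.copy triv_ext (k * M)%type.

Definition triv_mul (x y : triv_ext) : triv_ext := (x.1 * y.1, x.1 *: y.2 + y.1 *: x.2).

Lemma triv_mulA : associative triv_mul.
Proof.
move=> x y z; rewrite /triv_mul /= mulrA !scalerDr !scalerA addrA.
by rewrite [z.1 * x.1]mulrC [z.1 * y.1]mulrC.
Qed.

Lemma triv_mulC : commutative triv_mul.
Proof. by move=> x y; rewrite /triv_mul mulrC addrC. Qed.

Lemma triv_mul1 : left_id ((1, 0) : triv_ext) triv_mul.
Proof. by move=> [x m]; rewrite /triv_mul /= mul1r scale1r scaler0 addr0. Qed.

Lemma triv_mulD : left_distributive triv_mul +%R.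
Proof.
by move=> x y z; rewrite /triv_mul /= mulrDl !scalerDl !scalerDr [LHS]/= addrACA.
Qed.

Lemma triv_1n0 : ((1, 0) : triv_ext) != 0.
Proof. by apply/eqP => -[/eqP]; rewrite oner_eq0. Qed.

HB.instance Definition _ := GRing.Zmodule_isComNzRing.Build triv_ext
  triv_mulA triv_mulC triv_mul1 triv_mulD triv_1n0.

Definition triv_in (m : M) : triv_ext := (0, m).
Definition triv_scal (c : k) : triv_ext := (c, 0).

Lemma triv_scalB : zmod_morphism triv_scal.
Proof. by move=> c d; congr pair; rewrite /= subr0. Qed.

Lemma triv_scalM : monoid_morphism triv_scal.
Proof. by split=> // c d; congr pair; rewrite /= !scaler0 addr0. Qed.

HB.instance Definition _ := GRing.isZmodMorphism.Build k triv_ext triv_scal triv_scalB.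
HB.instance Definition _ := GRing.isMonoidMorphism.Build k triv_ext triv_scal triv_scalM.

Lemma triv_inB : zmod_morphism triv_in.
Proof. by move=> c d; congr pair; rewrite /= subr0. Qed.

HB.instance Definition _ := GRing.isZmodMorphism.Build M triv_ext triv_in triv_inB.

Lemma triv_inZ c m : triv_in (c *: m) = triv_scal c * triv_in m.
Proof. by congr pair; rewrite /= ?mulr0 // scale0r addr0. Qed.

Lemma triv_inI : injective triv_in. Proof. by move=> x y []. Qed.

Lemma triv_inD x y : triv_in (x + y) = triv_in x + triv_in y. Proof. exact: raddfD. Qed.

Lemma triv_inN x : triv_in (- x) = - triv_in x. Proof. exact: raddfN. Qed.

Lemma triv_in0 : triv_in 0 = 0. Proof. by []. Qed.

End TrivialExtension.

Ltac lmod := apply: triv_inI; rewrite !(triv_inD, triv_inN, triv_inZ, triv_in0); ring.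

Section LinearMaps.
Variables (k : fieldType) (U W : lmodType k) (f : U -> W) (fl : linear f).

Lemma lin0 : f 0 = 0.
Proof. by have := fl (-1) 0 0; rewrite scaler0 addr0 scaleN1r addNr. Qed.
Lemma linD u v : f (u + v) = f u + f v.
Proof. by have := fl 1 u v; rewrite !scale1r. Qed.
Lemma linZ c u : f (c *: u) = c *: f u.
Proof. by have := fl c u 0; rewrite lin0 !addr0. Qed.
Lemma linN u : f (- u) = - f u.
Proof. by rewrite -scaleN1r linZ scaleN1r. Qed.
Lemma lin_sum (J : Type) (r : seq J) (P : pred J) (F : J -> U) :
  f (\sum_(j <- r | P j) F j) = \sum_(j <- r | P j) f (F j).
Proof. by apply: (big_morph f) => [u v|]; rewrite ?lin0 ?linD. Qed.

End LinearMaps.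

(** * Calculus in A ⊗ A *)

Section TensorCalculus.
Variables (k : fieldType) (A : kalg k).
Implicit Types (x y z a b c : A) (t u v : tens2 A) (r : tens3 A) (l : k).

Lemma mulZl l x y : (l *: x) * y = l *: (x * y).
Proof. by rewrite kscaleAl. Qed.
Lemma mulZr l x y : x * (l *: y) = l *: (x * y).
Proof. by rewrite kscaleAr. Qed.

Lemma t2Dl x y z : t2 (x + y) z = t2 x z + t2 y z.
Proof. exact: (linD (t2_linearl z)). Qed.
Lemma t2Zl l y z : t2 (l *: y) z = l *: t2 y z.
Proof. exact: (linZ (t2_linearl z)). Qed.
Lemma t20l z : t2 0 z = 0.
Proof. exact: (lin0 (t2_linearl z)). Qed.
Lemma t2Dr x y z : t2 z (x + y) = t2 z x + t2 z y.
Proof. exact: (linD (t2_linearr z)). Qed.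
Lemma t2Zr l y z : t2 z (l *: y) = l *: t2 z y.
Proof. exact: (linZ (t2_linearr z)). Qed.
Lemma t20r z : t2 z 0 = 0.
Proof. exact: (lin0 (t2_linearr z)). Qed.

Lemma outer_linear x y : linear (fun t => outer x t y).
Proof.
apply: tens2_lift_linear => [b|a] l p q.
  by rewrite mulrDr -kscaleAr t2Dl t2Zl.
by rewrite mulrDl -kscaleAl t2Dr t2Zr.
Qed.

(** The inner bimodule structure of A ⊗ A; a double bracket is a derivation for
    it in its first argument, as it is for the outer one in its second. *)
Definition inner x t y : tens2 A := tens2_lift (fun a b => t2 (a * y) (x * b)) t.

Lemma inner_bilinear x y : (forall b, linear (fun a => t2 (a * y) (x * b))) /\
  (forall a, linear (fun b => t2 (a * y) (x * b))).
Proof.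
split=> [b|a] l p q; first by rewrite mulrDl -kscaleAl t2Dl t2Zl.
by rewrite mulrDr -kscaleAr t2Dr t2Zr.
Qed.

Lemma inner_linear x y : linear (fun t => inner x t y).
Proof. by have [? ?] := inner_bilinear x y; apply: tens2_lift_linear. Qed.

Lemma inner_t2 x a b y : inner x (t2 a b) y = t2 (a * y) (x * b).
Proof. by have [? ?] := inner_bilinear x y; rewrite /inner tens2_lift_t2. Qed.

Lemma tau12_linear : linear (@tau12 k A).
Proof. by apply: tens2_lift_linear => [b|a] l p q; rewrite ?t2Dl ?t2Dr ?t2Zl ?t2Zr. Qed.

Lemma outer0 x y : outer x 0 y = 0.
Proof. exact: (lin0 (outer_linear x y)). Qed.
Lemma outerD x y t u : outer x (t + u) y = outer x t y + outer x u y.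
Proof. exact: (linD (outer_linear x y)). Qed.
Lemma outerZ x y l t : outer x (l *: t) y = l *: outer x t y.
Proof. exact: (linZ (outer_linear x y)). Qed.
Lemma outerN x y t : outer x (- t) y = - outer x t y.
Proof. exact: (linN (outer_linear x y)). Qed.
Lemma inner0 x y : inner x 0 y = 0.
Proof. exact: (lin0 (inner_linear x y)). Qed.
Lemma innerD x y t u : inner x (t + u) y = inner x t y + inner x u y.
Proof. exact: (linD (inner_linear x y)). Qed.
Lemma innerZ x y l t : inner x (l *: t) y = l *: inner x t y.
Proof. exact: (linZ (inner_linear x y)). Qed.
Lemma innerN x y t : inner x (- t) y = - inner x t y.
Proof. exact: (linN (inner_linear x y)). Qed.
Lemma tau120 : tau12 0 = 0 :> tens2 A.
Proof. exact: (lin0 tau12_linear). Qed.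
Lemma tau12D t u : tau12 (t + u) = tau12 t + tau12 u.
Proof. exact: (linD tau12_linear). Qed.
Lemma tau12Z l t : tau12 (l *: t) = l *: tau12 t.
Proof. exact: (linZ tau12_linear). Qed.
Lemma tau12N t : tau12 (- t) = - tau12 t.
Proof. exact: (linN tau12_linear). Qed.

Definition tens2E := (outer0, outerD, outerZ, outerN, inner0, innerD, innerZ,
  innerN, tau120, tau12D, tau12Z, tau12N).

End TensorCalculus.

Ltac by_pure t :=
  elim/tensor_ind: t;
  [move=> ? ?; rewrite -?/(t2 _ _)
  |by rewrite ?tens2E ?scaler0 ?addr0
  |by move=> ? ?; rewrite ?tens2E => -> ->; try lmod
  |by move=> ? ?; rewrite ?tens2E => ->; try lmod].

Section OuterInner.
Variables (k : fieldType) (A : kalg k).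
Implicit Types (x y z a b c : A) (t u v : tens2 A) (r : tens3 A) (l : k).

Lemma tau12K : involutive (@tau12 k A).
Proof. by move=> t; by_pure t; rewrite !tau12_t2. Qed.

Lemma outer11 t : outer 1 t 1 = t.
Proof. by by_pure t; rewrite outer_t2 mul1r mulr1. Qed.

Lemma outer_outer x x' t y' y :
  outer x (outer x' t y') y = outer (x * x') t (y' * y).
Proof. by by_pure t; rewrite !outer_t2 !mulrA. Qed.

Lemma outer_inner x x' t y' y :
  outer x (inner x' t y') y = inner x' (outer x t y) y'.
Proof. by by_pure t; rewrite !(outer_t2, inner_t2) !mulrA. Qed.

Lemma tau12_outer x t y : tau12 (outer x t y) = inner x (tau12 t) y.
Proof. by by_pure t; rewrite ?(outer_t2, tau12_t2, inner_t2). Qed.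

Lemma tau12_inner x t y : tau12 (inner x t y) = outer x (tau12 t) y.
Proof. by rewrite -{1}[t]tau12K -tau12_outer tau12K. Qed.

Lemma outerDl x x' t y : outer (x + x') t y = outer x t y + outer x' t y.
Proof. by by_pure t; rewrite !outer_t2 mulrDl t2Dl. Qed.
Lemma outerZl l x t y : outer (l *: x) t y = l *: outer x t y.
Proof. by by_pure t; rewrite !outer_t2 mulZl t2Zl. Qed.
Lemma outerDr x t y y' : outer x t (y + y') = outer x t y + outer x t y'.
Proof. by by_pure t; rewrite !outer_t2 mulrDr t2Dr. Qed.
Lemma outerZr l x t y : outer x t (l *: y) = l *: outer x t y.
Proof. by by_pure t; rewrite !outer_t2 mulZr t2Zr. Qed.

End OuterInner.

(** * Derivations and coproducts over the base *)

Section SquareZeroAlgebra.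
Variables (k : fieldType) (A : kalg k).

Let M : lmodType k := ((ksort A : lmodType k) * tens2 A)%type.

Let mul (x y : M) : M := (x.1 * y.1, outer x.1 y.2 1 + outer 1 x.2 y.1).

Lemma derext_mulA : associative mul.
Proof.
move=> x y z; congr pair => /=; first exact: mulrA.
by rewrite !outerD !outer_outer !mul1r !mulr1 addrA.
Qed.
Lemma derext_mul1l : left_id ((1, 0) : M) mul.
Proof. by case=> x t; rewrite /mul /= mul1r outer11 outer0 addr0. Qed.
Lemma derext_mul1r : right_id ((1, 0) : M) mul.
Proof. by case=> x t; rewrite /mul /= mulr1 outer11 outer0 add0r. Qed.
Lemma derext_mulDl : left_distributive mul +%R.
Proof.
move=> x y z; congr pair => /=; first exact: mulrDl.
by rewrite outerDl outerD addrACA.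
Qed.
Lemma derext_mulDr : right_distributive mul +%R.
Proof.
move=> x y z; congr pair => /=; first exact: mulrDr.
by rewrite outerDr outerD addrACA.
Qed.
Lemma derext_scaleAl (c : k) x y : c *: mul x y = mul (c *: x) y.
Proof.
congr pair => /=; first by rewrite mulZl.
by rewrite outerZl outerZ scalerDr.
Qed.
Lemma derext_scaleAr (c : k) x y : c *: mul x y = mul x (c *: y).
Proof.
congr pair => /=; first by rewrite mulZr.
by rewrite outerZr outerZ scalerDr.
Qed.

(** The square-zero extension of A by the outer bimodule A ⊗ A: the maps
    x |-> (g x, d x) to it are multiplicative exactly when g is and d is a
    derivation along g. *)
Definition derext : kalg k := Kalg derext_mulA derext_mul1l derext_mul1r
  derext_mulDl derext_mulDr derext_scaleAl derext_scaleAr.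

End SquareZeroAlgebra.

Section Morphisms.
Variables (k : fieldType) (A R : kalg k).

(** Algebra maps that need not preserve 1, such as the map from the algebra of
    one color, whose unit goes to the sum of the idempotents of that color. *)
Definition nu_morphism (f : A -> R) :=
  linear f /\ forall x y, f (x * y) = f x * f y.

Definition outer_der (g : A -> R) (d : A -> tens2 R) :=
  linear d /\ forall x y, d (x * y) = outer 1 (d x) (g y) + outer (g x) (d y) 1.

End Morphisms.

Section Coproduct.
Variables (k : fieldType) (I C : finType) (V : C -> {set I}).

Definition part_vert (c : C) : finType := {s : I | s \in V c}.

Variables (A : kalg k) (e : I -> A).
Variables (P : C -> kalg k) (f : forall c, part_vert c -> P c).
Variable (io : forall c, P c -> A).

(** Existence in the universal property of the coproduct over the base; the piece
    P c is an algebra over the part of the base indexed by V c. *)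
Definition coproduct_ext := forall (R : kalg k) (E : I -> R)
    (g : forall c, P c -> R),
  is_idempotent_family E -> (forall c, nu_morphism (g c)) ->
  (forall c (s : part_vert c), g c (f s) = E (val s)) ->
  exists F : A -> R, [/\ nu_morphism F, F 1 = 1, forall s, F (e s) = E s &
    forall c x, F (io x) = g c x].

(** Gives uniqueness in the universal property.  When I and C are empty, only
    the condition at 0 makes S nonempty. *)
Definition coproduct_gen := forall S : A -> Prop, S 0 ->
  (forall l x y, S x -> S y -> S (l *: x + y)) ->
  (forall x y, S x -> S y -> S (x * y)) ->
  (forall s, S (e s)) -> (forall c (x : P c), S (io x)) -> forall x, S x.

Definition is_base_coproduct :=
  [/\ is_idempotent_family e, forall c, nu_morphism (@io c),
      forall c (s : part_vert c), io (f s) = e (val s),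
      coproduct_ext & coproduct_gen].

Hypothesis cop : is_base_coproduct.

Lemma coproduct_der_eq (D D' : A -> tens2 A) :
  outer_der id D -> outer_der id D' -> (forall s, D (e s) = D' (e s)) ->
  (forall c (x : P c), D (io x) = D' (io x)) -> D =1 D'.
Proof.
case: cop => _ _ _ _ gen [Dl DM] [Dl' DM'] es ps; apply: gen => //.
- by rewrite (lin0 Dl) (lin0 Dl').
- by move=> l x y ex ey; rewrite Dl Dl' ex ey.
- by move=> x y ex ey; rewrite DM DM' ex ey.
Qed.

(** Derivations extend from the pieces because they are algebra maps to the
    square-zero extension. *)
Lemma coproduct_der_ext (d : forall c, P c -> tens2 A) :
  (forall c, outer_der (@io c) (d c)) ->
  (forall c (s : part_vert c), d c (f s) = 0) ->
  exists D, [/\ outer_der id D, forall s, D (e s) = 0 &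
    forall c x, D (io x) = d c x].
Proof.
case: cop => [[eM e1] ioM ioe ext gen] dd d0.
pose E s : derext A := (e s, 0 : tens2 A).
pose g c x : derext A := (io (c:=c) x, d c x).
have [||c s|F [[Fl FM] F1 Fe Fg]] := ext (derext A) E g.
- split=> [s t|].
    rewrite -[LHS]/(e s * e t, outer (e s) 0 1 + outer 1 0 (e t)).
    by rewrite !outer0 addr0 eM; case: (s == t).
  rewrite /E -[RHS]/((1 : A), (0 : tens2 A)) -e1.
  apply/esym/(big_morph (fun x : A => (x, 0 : tens2 A) : derext A)) => // x y.
  by congr pair; rewrite /= addr0.
- move=> c; have [il iM] := ioM c; have [dl dM] := dd c.
  split=> [l x y|x y]; first by congr pair => /=; rewrite ?il ?dl.
  by rewrite /g iM dM addrC.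
- by rewrite /g ioe d0.
(* The first component is an endomorphism of A that fixes the generators. *)
have F_1 x : (F x).1 = x.
  apply: (gen (fun x => (F x).1 = x)) => {x}.
  - by rewrite (lin0 Fl).
  - by move=> l x y ex ey; rewrite Fl /= ex ey.
  - by move=> x y ex ey; rewrite FM /= ex ey.
  - by move=> s; rewrite Fe.
  - by move=> c x; rewrite Fg.
exists (fun x => (F x).2); split=> [|s|c x]; last by rewrite Fg.
- by split=> [l x y|x y]; rewrite ?Fl // FM /= !F_1 addrC.
by rewrite Fe.
Qed.

End Coproduct.

(** * The fused double bracket *)

Section PushForward.
Variables (k : fieldType) (A R : kalg k) (g : A -> R) (gm : nu_morphism g).

Definition push2 : tens2 A -> tens2 R := tens2_lift (fun x y => t2 (g x) (g y)).

Lemma push2_bilinear : (forall y, linear (fun x => t2 (g x) (g y))) /\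
  (forall x, linear (fun y => t2 (g x) (g y))).
Proof.
by case: gm => gl _; split=> ? l x y; rewrite gl ?t2Dl ?t2Dr ?t2Zl ?t2Zr.
Qed.

Lemma push2_linear : linear push2.
Proof. by have [? ?] := push2_bilinear; apply: tens2_lift_linear. Qed.

Lemma push2_t2 x y : push2 (t2 x y) = t2 (g x) (g y).
Proof. by have [? ?] := push2_bilinear; apply: tens2_lift_t2. Qed.

Definition push2E := (lin0 push2_linear, linD push2_linear, linZ push2_linear,
  linN push2_linear).

Lemma push2_tau12 t : push2 (tau12 t) = tau12 (push2 t).
Proof.
elim/tensor_ind: t => [a b||u v|l u].
- by rewrite -/(t2 a b) tau12_t2 !push2_t2 tau12_t2.
- by rewrite !(push2E, tens2E).
- by rewrite !(push2E, tens2E) => -> ->.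
- by rewrite !(push2E, tens2E) => ->.
Qed.

Lemma push2_outerl x t : push2 (outer x t 1) = outer (g x) (push2 t) 1.
Proof.
have [_ gM] := gm; elim/tensor_ind: t => [a b||u v|l u].
- by rewrite -/(t2 a b) outer_t2 !push2_t2 outer_t2 !mulr1 gM.
- by rewrite !(push2E, tens2E).
- by rewrite !(push2E, tens2E) => -> ->.
- by rewrite !(push2E, tens2E) => ->.
Qed.

Lemma push2_outerr t y : push2 (outer 1 t y) = outer 1 (push2 t) (g y).
Proof.
have [_ gM] := gm; elim/tensor_ind: t => [a b||u v|l u].
- by rewrite -/(t2 a b) outer_t2 !push2_t2 outer_t2 !mul1r gM.
- by rewrite !(push2E, tens2E).
- by rewrite !(push2E, tens2E) => -> ->.
- by rewrite !(push2E, tens2E) => ->.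
Qed.

End PushForward.

Section FusionTerm.
Variables (k : fieldType) (I : finType) (A : kalg k) (e : I -> A).
Hypothesis eM : forall s t, e s * e t = if s == t then e s else 0.
Implicit Types (a b c : A) (s u : I).

(** The term that a fusion at s contributes to the bracket of elements a and b of
    different pieces: the outer commutator of b with
    e_s ⊗ a e_s - e_s a ⊗ e_s. *)
Definition fus s a b : tens2 A :=
  t2 (b * e s) (a * e s) - t2 (e s) (a * e s * b) - t2 (b * e s * a) (e s)
  + t2 (e s * a) (e s * b).

Lemma fus_linearr s a : linear (fus s a).
Proof.
move=> l b c; rewrite /fus !(mulrDl, mulrDr, mulZl, mulZr).
by rewrite !(t2Dl, t2Dr, t2Zl, t2Zr); lmod.
Qed.

Lemma fusC s a b : fus s a b = tau12 (fus s b a).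
Proof. by rewrite /fus !tens2E !tau12_t2; lmod. Qed.

Lemma fusM s a b c :
  fus s a (b * c) = outer 1 (fus s a b) c + outer b (fus s a c) 1.
Proof. by rewrite /fus !tens2E !outer_t2 !(mul1r, mulr1, mulrA); lmod. Qed.

Lemma fus_base s a u : fus s a (e u) = 0.
Proof.
rewrite /fus -(mulrA a) !eM [u == s]eq_sym; case: eqP => [->|_].
  by lmod.
by rewrite !(mulr0, mul0r, t20l, t20r); lmod.
Qed.

Definition mixed (eps : I -> k) a b : tens2 A :=
  \sum_s (2%:R^-1 * eps s) *: fus s a b.

Lemma mixed_linearr eps a : linear (mixed eps a).
Proof.
move=> l b c; rewrite /mixed scaler_sumr -big_split; apply: eq_bigr => s _.
by rewrite fus_linearr; lmod.
Qed.

Lemma mixedC eps eps' a b : (forall s, eps' s = - eps s) ->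
  mixed eps a b = - tau12 (mixed eps' b a).
Proof.
move=> epsN; rewrite /mixed (lin_sum (@tau12_linear _ _)) -sumrN.
by apply: eq_bigr => s _; rewrite tens2E -fusC epsN; lmod.
Qed.

Lemma mixedM eps a b c :
  mixed eps a (b * c) = outer 1 (mixed eps a b) c + outer b (mixed eps a c) 1.
Proof.
rewrite /mixed !(lin_sum (outer_linear _ _)) -big_split.
by apply: eq_bigr => s _; rewrite fusM !tens2E; lmod.
Qed.

Lemma mixed_base eps a u : mixed eps a (e u) = 0.
Proof. by apply: big1 => s _; rewrite fus_base scaler0. Qed.

End FusionTerm.

Section BracketTheory.
Variables (k : fieldType) (I : finType) (A : kalg k) (e : I -> A).
Variables (br : A -> A -> tens2 A) (db : is_double_bracket e br).
Implicit Types (a b c x : A) (l : k).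

Lemma br_linearl b : linear (br^~ b). Proof. by case: db => [[]]. Qed.
Lemma br_linearr a : linear (br a). Proof. by case: db => [[]]. Qed.
Lemma base_elt_e (s : I) : base_elt e (fun t => (t == s)%:R) = e s.
Proof.
rewrite /base_elt (bigD1 s) //= eqxx scale1r big1 ?addr0 // => t /negbTE ->.
by rewrite scale0r.
Qed.

Lemma br_base s a : br (e s) a = 0 /\ br a (e s) = 0.
Proof. by case: db => _ br0 _ _; rewrite -base_elt_e; apply: br0. Qed.

Lemma brC a b : br a b = - tau12 (br b a). Proof. by case: db. Qed.

Lemma brMr a b c : br a (b * c) = outer 1 (br a b) c + outer b (br a c) 1.
Proof. by case: db. Qed.

Lemma brMl a b c : br (a * b) c = inner a (br b c) 1 + inner 1 (br a c) b.
Proof.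
by rewrite brC brMr !tens2E !tau12_outer [br b c]brC [br a c]brC !tens2E; lmod.
Qed.

End BracketTheory.

Section BracketExtension.
Variables (k : fieldType) (I C : finType) (V : C -> {set I}).
Variables (A : kalg k) (e : I -> A).
Variables (P : C -> kalg k) (f : forall c, part_vert V c -> P c).
Variable (io : forall c, P c -> A).
Hypothesis cop : is_base_coproduct e f io.
Variables (pb : forall c, P c -> P c -> tens2 (P c)).
Hypothesis pb_db : forall c, is_double_bracket (@f c) (@pb c).
Variable eps : C -> C -> I -> k.
Hypothesis epsN : forall c d s, eps d c s = - eps c d s.

Let eM : forall s t, e s * e t = if s == t then e s else 0.
Proof. by case: cop => [[]]. Qed.
Let iol c : linear (@io c).
Proof. by case: cop => _ /(_ c)[]. Qed.
Let ioM c (x y : P c) : io (x * y) = io x * io y.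
Proof. by case: cop => _ /(_ c)[]. Qed.
Let ioe c (s : part_vert V c) : io (f s) = e (val s).
Proof. by case: cop. Qed.
Let iom c : nu_morphism (@io c). Proof. by case: cop. Qed.

Definition gen_bracket c (a : P c) d : P d -> tens2 A :=
  dfwith (fun d (b : P d) => mixed e (eps c d) (io a) (io b))
         (fun b : P c => push2 (@io c) (pb a b)) d.

Lemma gen_bracket_same c (a b : P c) :
  gen_bracket a b = push2 (@io c) (pb a b).
Proof. by rewrite /gen_bracket dfwith_in. Qed.

Lemma gen_bracket_mixed c d (a : P c) (b : P d) : c != d ->
  gen_bracket a b = mixed e (eps c d) (io a) (io b).
Proof. by move=> cd; rewrite /gen_bracket dfwith_out. Qed.

Lemma gen_bracket_der c (a : P c) d : outer_der (@io d) (@gen_bracket c a d).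
Proof.
have [eq_cd|cd] := eqVneq c d; last first.
  split=> [l x y|x y]; rewrite !gen_bracket_mixed //.
    by rewrite iol mixed_linearr.
  by rewrite ioM mixedM.
subst d; split=> [l x y|x y]; rewrite !gen_bracket_same.
  by rewrite (br_linearr (pb_db c)) (push2_linear (iom c)).
by rewrite (brMr (pb_db c)) (linD (push2_linear (iom c))) push2_outerl // push2_outerr.
Qed.

Lemma gen_bracketC c d (a : P c) (b : P d) :
  gen_bracket a b = - tau12 (gen_bracket b a).
Proof.
have [eq_cd|cd] := eqVneq c d; last first.
  have dc : d != c by rewrite eq_sym.
  by rewrite !gen_bracket_mixed //; apply: mixedC => s; apply: epsN.
subst d; rewrite !gen_bracket_same (brC (pb_db c)).
by rewrite (linN (push2_linear (iom c))) push2_tau12.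
Qed.

Lemma gen_bracket_base c (a : P c) d (s : part_vert V d) :
  gen_bracket a (f s) = 0.
Proof.
have [eq_cd|cd] := eqVneq c d; last first.
  by rewrite gen_bracket_mixed // ioe mixed_base.
subst d; rewrite gen_bracket_same (br_base (pb_db c) _ _).2.
by rewrite (lin0 (push2_linear (iom c))).
Qed.

(** The bracket is extended one argument at a time.  For a in a piece, D a is the
    derivation of A prescribed on the pieces; for x in A, a |-> tau12 (D a x) is
    again an outer derivation on each piece, and E x is its extension to A. *)
Lemma bracket_extension : exists br : A -> A -> tens2 A,
  [/\ is_double_bracket e br,
    forall c (a b : P c), br (io a) (io b) = push2 (@io c) (pb a b) &
    forall c d (a : P c) (b : P d), c != d ->
      br (io a) (io b) = mixed e (eps c d) (io a) (io b)].
Proof.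
have der_eq := coproduct_der_eq cop.
have [D HD] : exists D : forall c, P c -> A -> tens2 A, forall c (a : P c),
    [/\ outer_der id (D c a), forall s, D c a (e s) = 0 &
        forall d (b : P d), D c a (io b) = gen_bracket a b].
  have := fun c => @choice _ _ (fun (a : P c) Da =>
    [/\ outer_der id Da, forall s, Da (e s) = 0 &
        forall d (b : P d), Da (io b) = gen_bracket a b]).
  move=> ch; have {}ch c := ch c (fun a => coproduct_der_ext cop
    (@gen_bracket_der c a) (@gen_bracket_base c a)).
  by exists (fun c => projT1 (ch c)) => c a; have := projT2 (ch c) a.
have Dd c a : outer_der id (D c a) by case: (HD c a).
have De c a s : D c a (e s) = 0 by case: (HD c a).
have Dg c a d (b : P d) : D c a (io b) = gen_bracket a b by case: (HD c a).
pose S c (a : P c) x := tau12 (D c a x).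
have Sg c a d (b : P d) : S c a (io b) = - gen_bracket b a.
  by rewrite /S Dg gen_bracketC tens2E tau12K.
(* Linearity and the Leibniz rule in a hold on generators x; both sides are
   outer derivations in x, as the outer and the inner structure commute. *)
have Dl c x : linear (D c ^~ x).
  move=> l a b; apply: (der_eq (D c (l *: a + b)) (fun x => l *: D c a x + D c b x)).
  - exact: Dd.
  - have [al aM] := Dd c a; have [bl bM] := Dd c b.
    split=> [m y z|y z]; first by rewrite al bl; lmod.
    by rewrite aM bM !tens2E; lmod.
  - by move=> s; rewrite !De; lmod.
  - move=> d y; rewrite !Dg [LHS]gen_bracketC.
    rewrite (gen_bracket_der y c).1 !tens2E.
    by rewrite [in RHS]gen_bracketC [gen_bracket b _]gen_bracketC; lmod.
have DM c (a b : P c) x :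
    D c (a * b) x = inner (io a) (D c b x) 1 + inner 1 (D c a x) (io b).
  apply: (der_eq (D c (a * b))
    (fun x => inner (io a) (D c b x) 1 + inner 1 (D c a x) (io b))).
  - exact: Dd.
  - have [al aM] := Dd c a; have [bl bM] := Dd c b.
    split=> [m y z|y z]; first by rewrite al bl !tens2E; lmod.
    by rewrite aM bM !tens2E !outer_inner; lmod.
  - by move=> s; rewrite !De !tens2E; lmod.
  - move=> d y; rewrite !Dg [LHS]gen_bracketC.
    rewrite (gen_bracket_der y c).2 !tens2E !tau12_outer.
    by rewrite [gen_bracket a y]gen_bracketC [gen_bracket b y]gen_bracketC !tens2E; lmod.
have De' c (s : part_vert V c) x : D c (f s) x = 0.
  apply: (der_eq (D c (f s)) (fun=> 0)) => //.
  - split=> [l y z|y z]; rewrite ?tens2E; lmod.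
  - by move=> d y; rewrite Dg gen_bracketC gen_bracket_base tens2E oppr0.
have [E HE] : exists E : A -> A -> tens2 A, forall x,
    [/\ outer_der id (E x), forall s, E x (e s) = 0 &
        forall c (a : P c), E x (io a) = tau12 (D c a x)].
  have := @choice _ _ (fun (x : A) Ex => [/\ outer_der id Ex, forall s, Ex (e s) = 0 &
    forall c (a : P c), Ex (io a) = tau12 (D c a x)]).
  move=> ch; suff /ch[E HE] : forall x, exists Ex : A -> tens2 A,
      [/\ outer_der id Ex, forall s, Ex (e s) = 0 &
        forall c (a : P c), Ex (io a) = tau12 (D c a x)] by exists E.
  move=> x; apply: (coproduct_der_ext cop).
  - move=> c; split=> [l a b|a b]; first by rewrite Dl !tens2E.
    by rewrite DM !tens2E !tau12_inner addrC.
  - by move=> c s; rewrite De' tens2E.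
have Ed x : outer_der id (E x) by case: (HE x).
have Ee x s : E x (e s) = 0 by case: (HE x).
have Eg x c (a : P c) : E x (io a) = tau12 (D c a x) by case: (HE x).
pose br a x := tau12 (E x a).
have brMl a b x : br (a * b) x = inner a (br b x) 1 + inner 1 (br a x) b.
  by rewrite /br (Ed x).2 !tens2E !tau12_outer addrC.
have brg c (a : P c) x : br (io a) x = D c a x by rewrite /br Eg tau12K.
have brl x : linear (br ^~ x).
  by move=> l a b; rewrite /br (Ed x).1 !tens2E.
(* For fixed second argument, br is an inner derivation by construction; that it
   is an outer derivation in the second argument is inherited by products. *)
have brd a : outer_der id (br a) /\ forall s, br a (e s) = 0.
  have [_ _ _ _ gen] := cop; move: a; apply: gen.
  - split; last by move=> s; rewrite (lin0 (brl _)).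
    by split=> [l y z|y z]; rewrite !(lin0 (brl _)) ?tens2E; lmod.
  - move=> l a b [[al aM] a0] [[bl bM] b0]; split; last first.
      by move=> s; rewrite brl a0 b0; lmod.
    split=> [m y z|y z]; first by rewrite !brl al bl; lmod.
    by rewrite !brl aM bM !tens2E; lmod.
  - move=> a b [[al aM] a0] [[bl bM] b0]; split; last first.
      by move=> s; rewrite brMl a0 b0 !tens2E; lmod.
    split=> [m y z|y z]; first by rewrite !brMl al bl !tens2E; lmod.
    by rewrite !brMl aM bM !tens2E !outer_inner; lmod.
  - move=> s; split; last by move=> t; rewrite /br Ee tens2E.
    by split=> [m y z|y z]; rewrite /br !Ee !tens2E; lmod.
  - move=> c a; split; last by move=> s; rewrite brg De.
    by split=> [m y z|y z]; rewrite !brg ?(Dd c a).1 ?(Dd c a).2.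
have Ned x : outer_der id (fun y => - E x y).
  split=> [m y z|y z]; first by rewrite (Ed x).1; lmod.
  by rewrite (Ed x).2 !tens2E; lmod.
(* Antisymmetry compares two derivations, first with one argument in a piece. *)
have brCg c (a : P c) x : br (io a) x = - tau12 (br x (io a)).
  rewrite /br tau12K; apply: (der_eq (br (io a)) (fun y => - E (io a) y)).
  - by have [] := brd (io a).
  - exact: Ned.
  - by move=> s; rewrite (brd _).2 Ee oppr0.
  - by move=> d b; rewrite brg Dg Eg Dg -gen_bracketC.
have brC a b : br a b = - tau12 (br b a).
  rewrite /br tau12K; apply: (der_eq (br a) (fun y => - E a y)).
  - by have [] := brd a.
  - exact: Ned.
  - by move=> s; rewrite (brd _).2 Ee oppr0.
  - move=> d x; rewrite -[E _ _]tau12K -/(br _ _) [br (io x) _]brCg.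
    by rewrite tens2E tau12K opprK.
exists br; split.
- split=> [|x a|//|a]; last by have [[]] := brd a.
  + by split=> // a; have [[]] := brd a.
  + rewrite /base_elt; split.
      rewrite (lin_sum (brl a)); apply: big1 => s _.
      by rewrite (linZ (brl a)) /br Ee tens2E scaler0.
    have [[al _] a0] := brd a.
    by rewrite (lin_sum al) big1 // => s _; rewrite (linZ al) a0 scaler0.
- by move=> c a b; rewrite brg Dg gen_bracket_same.
- by move=> c d a b cd; rewrite brg Dg gen_bracket_mixed.
Qed.

End BracketExtension.

(** * Triple brackets *)

Section Tensor3.
Variables (k : fieldType) (A : kalg k).
Implicit Types (x y z a b c : A) (t u v : tens2 A) (r : tens3 A) (l : k).

Lemma pureDl u v z : pure (u + v) z = pure u z + pure v z :> tens3 A.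
Proof. exact: (linD (pure_linearl z)). Qed.
Lemma pureZl l u z : pure (l *: u) z = l *: pure u z :> tens3 A.
Proof. exact: (linZ (pure_linearl z)). Qed.
Lemma pureNl u z : pure (- u) z = - pure u z :> tens3 A.
Proof. exact: (linN (pure_linearl z)). Qed.
Lemma pure0l z : pure (0 : tens2 A) z = 0 :> tens3 A.
Proof. exact: (lin0 (pure_linearl z)). Qed.
Lemma pureDr u x y : pure u (x + y) = pure u x + pure u y :> tens3 A.
Proof. exact: (linD (pure_linearr u)). Qed.
Lemma pureZr u l x : pure u (l *: x) = l *: pure u x :> tens3 A.
Proof. exact: (linZ (pure_linearr u)). Qed.
Lemma pure0r u : pure u (0 : A) = 0 :> tens3 A.
Proof. exact: (lin0 (pure_linearr u)). Qed.

Lemma tens3_lift_linear (W : lmodType k) (f : A -> A -> A -> W) :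
  (forall y z, linear (fun x => f x y z)) ->
  (forall x z, linear (fun y => f x y z)) -> (forall x y, linear (f x y)) ->
  linear (tens3_lift f).
Proof.
move=> f1 f2 f3; have lin z : linear (tens2_lift (fun x y => f x y z)).
  exact: tens2_lift_linear.
apply: tlift_linear => // t l y z.
elim/tensor_ind: t => [a b||u v|m u].
- by rewrite -/(t2 a b) !tens2_lift_t2 // f3.
- by rewrite !(lin0 (lin _)) scaler0 addr0.
- by rewrite !(linD (lin _)) => -> ->; rewrite scalerDr addrACA.
- by rewrite !(linZ (lin _)) => ->; rewrite scalerDr !scalerA mulrC.
Qed.

Lemma tau123_linear : linear (@tau123 k A).
Proof.
apply: tens3_lift_linear => ? ?.
- exact: t3_linear2.
- exact: t3_linear3.
- exact: t3_linear1.
Qed.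

Lemma tau132_linear : linear (@tau132 k A).
Proof.
apply: tens3_lift_linear => ? ?.
- exact: t3_linear3.
- exact: t3_linear1.
- exact: t3_linear2.
Qed.

Definition outer3 x r y : tens3 A :=
  tlift (fun (t : tens2 A) (c : A) => pure (outer x t 1) (c * y) : tens3 A) r.

Lemma outer3_bilinear x y :
  (forall c, linear (fun t : tens2 A => pure (outer x t 1) (c * y) : tens3 A)) /\
  (forall t, linear (fun c : A => pure (outer x t 1) (c * y) : tens3 A)).
Proof.
split=> [c|t] l p q; first by rewrite outer_linear pure_linearl.
by rewrite mulrDl mulZl pure_linearr.
Qed.

Lemma outer3_linear x y : linear (fun r => outer3 x r y).
Proof. by have [? ?] := outer3_bilinear x y; apply: tlift_linear. Qed.

Lemma outer3_pure x t c y : outer3 x (pure t c) y = pure (outer x t 1) (c * y).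
Proof. by have [? ?] := outer3_bilinear x y; rewrite /outer3 tlift_pure. Qed.

Lemma outer3_t3 x a b c y : outer3 x (t3 a b c) y = t3 (x * a) b (c * y).
Proof. by rewrite /t3 outer3_pure outer_t2 mulr1. Qed.

(** The product of p ⊗ q and x ⊗ y is p ⊗ qx ⊗ y, the shape of the terms by which the
    summands of the triple bracket fail to be derivations. *)
Definition concat u v : tens3 A :=
  tens2_lift (fun x y => pure (outer 1 u x) y : tens3 A) v.

Lemma concat_bilinear u :
  (forall y, linear (fun x => pure (outer 1 u x) y : tens3 A)) /\
  (forall x, linear (fun y : A => pure (outer 1 u x) y : tens3 A)).
Proof.
split=> [y|x] l p q; last by rewrite pure_linearr.
by rewrite outerDr outerZr pureDl pureZl.
Qed.

Lemma concat_linearr u : linear (concat u).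
Proof. by have [? ?] := concat_bilinear u; apply: tens2_lift_linear. Qed.

Lemma concat_t2 u x y : concat u (t2 x y) = pure (outer 1 u x) y.
Proof. by have [? ?] := concat_bilinear u; rewrite /concat tens2_lift_t2. Qed.

Lemma concat_linearl v : linear (concat^~ v).
Proof.
move=> l p q; elim/tensor_ind: v => [x y||u v|m u].
- by rewrite -/(t2 x y) !concat_t2 outerD outerZ pureDl pureZl.
- by rewrite !(lin0 (concat_linearr _)); lmod.
- by rewrite !(linD (concat_linearr _)) => -> ->; lmod.
- by rewrite !(linZ (concat_linearr _)) => ->; lmod.
Qed.

Definition tens3E := (pureDl, pureZl, pureNl, pure0l, pureDr, pureZr, pure0r,
  lin0 tau123_linear, linD tau123_linear, linZ tau123_linear, linN tau123_linear,
  lin0 tau132_linear, linD tau132_linear, linZ tau132_linear, linN tau132_linear).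

Lemma outer30 x y : outer3 x 0 y = 0.
Proof. exact: (lin0 (outer3_linear x y)). Qed.
Lemma outer3D x y p q : outer3 x (p + q) y = outer3 x p y + outer3 x q y.
Proof. exact: (linD (outer3_linear x y)). Qed.
Lemma outer3Z x y l p : outer3 x (l *: p) y = l *: outer3 x p y.
Proof. exact: (linZ (outer3_linear x y)). Qed.
Lemma outer3N x y p : outer3 x (- p) y = - outer3 x p y.
Proof. exact: (linN (outer3_linear x y)). Qed.
Lemma concat0l v : concat 0 v = 0.
Proof. exact: (lin0 (concat_linearl v)). Qed.
Lemma concatDl v p q : concat (p + q) v = concat p v + concat q v.
Proof. exact: (linD (concat_linearl v)). Qed.
Lemma concatZl v l p : concat (l *: p) v = l *: concat p v.
Proof. exact: (linZ (concat_linearl v)). Qed.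
Lemma concatNl v p : concat (- p) v = - concat p v.
Proof. exact: (linN (concat_linearl v)). Qed.
Lemma concat0r v : concat v 0 = 0.
Proof. exact: (lin0 (concat_linearr v)). Qed.
Lemma concatDr v p q : concat v (p + q) = concat v p + concat v q.
Proof. exact: (linD (concat_linearr v)). Qed.
Lemma concatZr v l p : concat v (l *: p) = l *: concat v p.
Proof. exact: (linZ (concat_linearr v)). Qed.

Definition outer3E := (outer30, outer3D, outer3Z, outer3N).
Definition concatE := (concat0l, concatDl, concatZl, concatNl, concat0r,
  concatDr, concatZr).

End Tensor3.

Ltac by_pure3 t :=
  elim/tensor_ind: t;
  [move=> ? ?; rewrite -?/(t2 _ _) ?tens2E
  |by rewrite ?(tens2E, tens3E, outer3E, concatE); try lmod
  |by move=> ? ?; rewrite ?(tens2E, tens3E, outer3E, concatE) => -> ->; try lmod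
  |by move=> ? ?; rewrite ?(tens2E, tens3E, outer3E, concatE) => ->; try lmod].

Section Tensor3Cyclic.
Variables (k : fieldType) (A : kalg k).
Implicit Types (x y z p q : A) (u : tens2 A) (r : tens3 A).

Lemma tau123_tau123 r : tau123 (tau123 r) = tau132 r.
Proof.
elim/tensor_ind: r => [u x||? ?|? ?].
- by by_pure3 u; rewrite -!/(t3 _ _ _) !tau123_t3 tau132_t3.
- by rewrite !tens3E.
- by rewrite !tens3E => -> ->.
- by rewrite !tens3E => ->.
Qed.

Lemma tau123_tau132 r : tau123 (tau132 r) = r.
Proof.
elim/tensor_ind: r => [u x||? ?|? ?].
- by by_pure3 u; rewrite -!/(t3 _ _ _) !tau132_t3 tau123_t3.
- by rewrite !tens3E.
- by rewrite !tens3E => -> ->.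
- by rewrite !tens3E => ->.
Qed.

Lemma tau123_innerl z u x :
  tau123 (pure u (z * x)) = outer3 z (tau123 (pure u x)) 1.
Proof. by by_pure3 u; rewrite -!/(t3 _ _ _) !tau123_t3 outer3_t3 mulr1. Qed.

Lemma tau123_pure_outerr u z x :
  tau123 (pure (outer 1 u z) x) = outer3 1 (tau123 (pure u x)) z.
Proof.
by by_pure3 u; rewrite outer_t2 -!/(t3 _ _ _) !tau123_t3 outer3_t3 !mul1r.
Qed.

Lemma tau123_pure_outerl p u x :
  tau123 (pure (outer p u 1) x) = concat (t2 x p) u.
Proof.
by by_pure3 u; rewrite outer_t2 -/(t3 _ _ _) tau123_t3 concat_t2 outer_t2 mul1r mulr1.
Qed.

Lemma tau132_pure_innerl z u x :
  tau132 (pure (inner z u 1) x) = outer3 z (tau132 (pure u x)) 1.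
Proof.
by by_pure3 u; rewrite inner_t2 -!/(t3 _ _ _) !tau132_t3 outer3_t3 !mulr1.
Qed.

Lemma tau132_pure_innerr u z x :
  tau132 (pure (inner 1 u z) x) = outer3 1 (tau132 (pure u x)) z.
Proof.
by by_pure3 u; rewrite inner_t2 -!/(t3 _ _ _) !tau132_t3 outer3_t3 !mul1r.
Qed.

End Tensor3Cyclic.

Section TripleBracket.
Variables (k : fieldType) (I : finType) (A : kalg k) (e : I -> A).
Variables (br : A -> A -> tens2 A) (db : is_double_bracket e br).
Implicit Types (a b c x y z : A) (u : tens2 A) (l : k).

Lemma bracketL_linear a : linear (bracketL br a).
Proof.
apply: tens2_lift_linear => c l x y; last by rewrite pure_linearr.
by rewrite (br_linearr db) pure_linearl.
Qed.

Lemma bracketLE a x y : bracketL br a (t2 x y) = pure (br a x) y.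
Proof. by rewrite bracketL_t2 //; apply: (br_linearr db). Qed.

Lemma bracketL0 a : bracketL br a 0 = 0.
Proof. exact: (lin0 (bracketL_linear a)). Qed.
Lemma bracketLD a p q : bracketL br a (p + q) = bracketL br a p + bracketL br a q.
Proof. exact: (linD (bracketL_linear a)). Qed.
Lemma bracketLZ a l p : bracketL br a (l *: p) = l *: bracketL br a p.
Proof. exact: (linZ (bracketL_linear a)). Qed.
Lemma bracketLN a p : bracketL br a (- p) = - bracketL br a p.
Proof. exact: (linN (bracketL_linear a)). Qed.

Definition bLE := (bracketL0, bracketLD, bracketLZ, bracketLN, @tens2E k A,
  @tens3E k A, @outer3E k A, @concatE k A).

Lemma bracketL_linearl u : linear (bracketL br^~ u).
Proof.
move=> l a b; elim/tensor_ind: u => [x y||? ?|? ?].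
- by rewrite -/(t2 x y) !bracketLE (br_linearl db) pure_linearl.
- by rewrite !bLE; lmod.
- by rewrite !bLE => -> ->; lmod.
- by rewrite !bLE => ->; lmod.
Qed.

Local Ltac bt u :=
  elim/tensor_ind: u;
  [move=> ? ?; rewrite -?/(t2 _ _)
  |by rewrite !bLE; try lmod
  |by move=> ? ?; rewrite !bLE => -> ->; try lmod
  |by move=> ? ?; rewrite !bLE => ->; try lmod].

Lemma bracketL_outerr a u y :
  bracketL br a (outer 1 u y) = outer3 1 (bracketL br a u) y.
Proof. by bt u; rewrite outer_t2 !bracketLE outer3_pure mul1r outer11. Qed.

Lemma bracketL_outerl a x u :
  bracketL br a (outer x u 1) = outer3 x (bracketL br a u) 1 + concat (br a x) u.
Proof.
bt u; rewrite outer_t2 !bracketLE outer3_pure !mulr1 concat_t2 (brMr db) pureDl.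
exact: addrC.
Qed.

Lemma tau123_bracketL_innerl z b u :
  tau123 (bracketL br b (inner z u 1)) = outer3 z (tau123 (bracketL br b u)) 1.
Proof. by bt u; rewrite inner_t2 !bracketLE mulr1 tau123_innerl. Qed.

Lemma tau123_bracketL_innerr b u z :
  tau123 (bracketL br b (inner 1 u z)) =
  outer3 1 (tau123 (bracketL br b u)) z + concat (tau12 u) (br b z).
Proof.
bt u; rewrite inner_t2 !bracketLE mul1r (brMr db) !tens3E.
by rewrite tau123_pure_outerr tau123_pure_outerl tau12_t2.
Qed.

Lemma tau132_bracketL_mul z z' u :
  tau132 (bracketL br (z * z') u) =
  outer3 z (tau132 (bracketL br z' u)) 1 + outer3 1 (tau132 (bracketL br z u)) z'.
Proof.
bt u; rewrite !bracketLE (brMl db) !tens3E.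
by rewrite tau132_pure_innerl tau132_pure_innerr.
Qed.

(** The defects of the first two summands are opposite, by antisymmetry. *)
Lemma triple_bracketM a b z z' :
  triple_bracket br a b (z * z') =
  outer3 1 (triple_bracket br a b z) z' + outer3 z (triple_bracket br a b z') 1.
Proof.
rewrite /triple_bracket (brMr db) (brMl db) !bLE.
rewrite bracketL_outerr bracketL_outerl tau123_bracketL_innerl.
rewrite tau123_bracketL_innerr tau132_bracketL_mul.
by rewrite [br a z](brC db) !bLE; lmod.
Qed.

Lemma triple_bracket_linear a b : linear (triple_bracket br a b).
Proof.
move=> l z z'; rewrite /triple_bracket (br_linearr db) (br_linearl db) bracketL_linearl.
by rewrite !bLE; lmod.
Qed.

Lemma triple_bracket_base a b s : triple_bracket br a b (e s) = 0.
Proof.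
rewrite /triple_bracket (br_base db s _).1 (br_base db s _).2 !bLE.
have -> u : bracketL br (e s) u = 0.
  by bt u; rewrite bracketLE (br_base db s _).1 pure0l.
by rewrite tens3E; lmod.
Qed.

Lemma triple_bracketC a b c :
  triple_bracket br a b c = tau123 (triple_bracket br b c a).
Proof.
rewrite /triple_bracket !tens3E tau123_tau123 tau123_tau132.
by lmod.
Qed.

End TripleBracket.

(** * The quasi-Poisson property on generators *)

Section QuasiPoissonTerm.
Variables (k : fieldType) (I : finType) (A : kalg k) (e : I -> A).
Hypothesis eM : forall s t, e s * e t = if s == t then e s else 0.
Implicit Types (a b c z : A) (s : I).

Definition qP_term s a b c : tens3 A :=
  t3 (c * e s * a) (e s * b) (e s) - t3 (c * e s * a) (e s) (b * e s)
  - t3 (c * e s) (a * e s * b) (e s) + t3 (c * e s) (a * e s) (b * e s)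
  - t3 (e s * a) (e s * b) (e s * c) + t3 (e s * a) (e s) (b * e s * c)
  + t3 (e s) (a * e s * b) (e s * c) - t3 (e s) (a * e s) (b * e s * c).

Lemma qP_bracketE a b c :
  qP_bracket e a b c = (4%:R : k)^-1 *: \sum_s qP_term s a b c.
Proof. by []. Qed.

Lemma qP_termC s a b c : qP_term s a b c = tau123 (qP_term s b c a).
Proof. by rewrite /qP_term !tens3E !tau123_t3; lmod. Qed.

Lemma t3E1 (l : k) x y b c : t3 (l *: x + y) b c = l *: t3 x b c + t3 y b c :> tens3 A.
Proof. by rewrite /t3 t2Dl t2Zl !tens3E. Qed.
Lemma t3E3 (l : k) x y b c : t3 b c (l *: x + y) = l *: t3 b c x + t3 b c y :> tens3 A.
Proof. by rewrite /t3 !tens3E. Qed.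
Lemma t30l b c : t3 0 b c = 0 :> tens3 A.
Proof. by rewrite /t3 t20l pure0l. Qed.
Lemma t30m b c : t3 b 0 c = 0 :> tens3 A.
Proof. by rewrite /t3 t20r pure0l. Qed.
Lemma t30r b c : t3 b c 0 = 0 :> tens3 A.
Proof. by rewrite /t3 pure0r. Qed.

Lemma qP_term_linear s a b : linear (qP_term s a b).
Proof.
move=> l x y; rewrite /qP_term !(mulrDl, mulrDr) !(mulZl, mulZr) !t3E1 !t3E3.
by lmod.
Qed.

Lemma qP_termM s a b z z' :
  qP_term s a b (z * z') =
  outer3 1 (qP_term s a b z) z' + outer3 z (qP_term s a b z') 1.
Proof. by rewrite /qP_term !outer3E !outer3_t3 !mul1r !mulr1 !mulrA; lmod. Qed.

Lemma qP_term_base s a b t : qP_term s a b (e t) = 0.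
Proof.
rewrite /qP_term -!(mulrA b) !eM [t == s]eq_sym; case: eqP => [->|_]; first by lmod.
by rewrite !(mulr0, mul0r) !(t30l, t30r); lmod.
Qed.

End QuasiPoissonTerm.

Section QuasiPoissonGenerators.
Variables (k : fieldType) (I : finType) (A : kalg k) (e : I -> A).
Hypothesis eM : forall s t, e s * e t = if s == t then e s else 0.
Variables (br : A -> A -> tens2 A) (db : is_double_bracket e br).
Variable G : A -> Prop.
Hypothesis gen : forall S : A -> Prop, S 0 ->
  (forall l x y, S x -> S y -> S (l *: x + y)) ->
  (forall x y, S x -> S y -> S (x * y)) ->
  (forall s, S (e s)) -> (forall x, G x -> S x) -> forall x, S x.

Let qp a b c := triple_bracket br a b c = qP_bracket e a b c.

Lemma qp_rot a b c : qp b c a -> qp a b c.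
Proof.
rewrite /qp => qp_bca; rewrite triple_bracketC qp_bca !qP_bracketE tens3E; congr (_ *: _).
by rewrite (lin_sum (@tau123_linear _ _)); apply: eq_bigr => s _; rewrite -qP_termC.
Qed.

Lemma qp_third a b : (forall c, G c -> qp a b c) -> forall c, qp a b c.
Proof.
move=> Gqp; apply: gen => // [|l x y|x y|s]; rewrite /qp !qP_bracketE.
- rewrite (lin0 (triple_bracket_linear db a b)) big1 ?scaler0 // => s _.
  exact: (lin0 (qP_term_linear _ _ _ _)).
- move=> ex ey; rewrite (triple_bracket_linear db) ex ey scalerA mulrC -scalerA.
  rewrite -scalerDr scaler_sumr -big_split; congr (_ *: _).
  by apply: eq_bigr => s _; rewrite qP_term_linear.
- move=> ex ey; rewrite (triple_bracketM db) ex ey !outer3E -scalerDr.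
  congr (_ *: _); rewrite !(lin_sum (outer3_linear _ _)) -big_split.
  by apply: eq_bigr => s _; rewrite qP_termM.
- rewrite (triple_bracket_base db) big1 ?scaler0 // => t _.
  exact: qP_term_base.
Qed.

(** One argument at a time is freed from the generators, after rotating it into
    the last place. *)
Lemma quasi_poisson_generators :
  (forall a b c, G a -> G b -> G c -> qp a b c) -> is_quasi_poisson e br.
Proof.
move=> Gqp.
have qp1 a b c : G a -> G b -> qp a b c.
  by move=> Ga Gb; apply: qp_third => {}c Gc; apply: Gqp.
have qp2 a b c : G a -> qp a b c.
  by move=> Ga; apply/qp_rot/qp_rot/qp_third => d Gd; apply/qp_rot/qp1.
by move=> a b c; apply: qp_rot; apply: qp_third => d Gd; apply/qp_rot/qp_rot/qp2.
Qed.

End QuasiPoissonGenerators.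

Section FusionTriple.
Variables (k : fieldType) (I : finType) (A : kalg k) (e : I -> A).
Hypothesis eM : forall s t, e s * e t = if s == t then e s else 0.
Implicit Types (a b z p q : A) (s t : I) (u v : tens2 A) (al be : I -> k) (l : k).

(** The values of bracketL br a on fus s b z come from differentiating z, which
    gives third_fus s (br a z) b, and from differentiating b, which gives
    second_fus s (br a b) z. *)
Definition third_fus s u b : tens3 A :=
  pure (outer 1 u (e s)) (b * e s) - pure (outer 1 u (e s * b)) (e s).

Definition second_fus s v z : tens3 A :=
  pure (outer (e s) v 1) (e s * z) - pure (outer (z * e s) v 1) (e s).

Lemma third_fus_linear s b : linear (third_fus s ^~ b).
Proof. by move=> l u v; rewrite /third_fus !(tens2E, tens3E); lmod. Qed.

Lemma second_fus_linear s z : linear (second_fus s ^~ z).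
Proof. by move=> l u v; rewrite /second_fus !(tens2E, tens3E); lmod. Qed.

Definition third_mix al u b := \sum_s (2%:R^-1 * al s) *: third_fus s u b.
Definition second_mix al v z := \sum_s (2%:R^-1 * al s) *: second_fus s v z.

Lemma third_mix_linear al b : linear (third_mix al ^~ b).
Proof.
move=> l u v; rewrite /third_mix scaler_sumr -big_split; apply: eq_bigr => s _.
by rewrite third_fus_linear; lmod.
Qed.

Lemma second_mix_linear al z : linear (second_mix al ^~ z).
Proof.
move=> l u v; rewrite /second_mix scaler_sumr -big_split; apply: eq_bigr => s _.
by rewrite second_fus_linear; lmod.
Qed.

Lemma third_mixN al be u b : (forall s, be s = - al s) ->
  third_mix be u b = - third_mix al u b.
Proof.
move=> beN; rewrite /third_mix -sumrN; apply: eq_bigr => s _.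
by rewrite beN; lmod.
Qed.

Lemma second_mixN al be v z : (forall s, be s = - al s) ->
  second_mix be v z = - second_mix al v z.
Proof.
move=> beN; rewrite /second_mix -sumrN; apply: eq_bigr => s _.
by rewrite beN; lmod.
Qed.

(** The heart of the quasi-Poisson property: terms at distinct vertices cancel
    between two consecutive summands of the triple bracket, and those at one
    vertex add up to the quasi-Poisson term. *)
Lemma third_second_fus s t a b z :
  third_fus s (fus e t a z) b - tau123 (second_fus t (fus e s b z) a) =
  if s == t then qP_term e s a b z else 0.
Proof.
have eMr x s' t' : x * e s' * e t' = if s' == t' then x * e s' else 0.
  by rewrite -mulrA eM; case: ifP => // _; rewrite mulr0.
rewrite /third_fus /second_fus /fus !(tens2E, tens3E) !outer_t2.
rewrite !(mul1r, mulr1) !mulrA !(eM, eMr).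
rewrite -!/(t3 _ _ _) !tau123_t3.
rewrite [t == s]eq_sym; case: eqP => [->|_].
  by rewrite /qP_term; lmod.
by rewrite !(mul0r, t30l, t30m, t30r); lmod.
Qed.

Lemma third_second_mix al be a b z :
  third_mix al (mixed e be a z) b = tau123 (second_mix be (mixed e al b z) a) +
  (4%:R : k)^-1 *: \sum_s (al s * be s) *: qP_term e s a b z.
Proof.
apply/eqP; rewrite addrC -subr_eq; apply/eqP; rewrite /third_mix /second_mix.
rewrite (lin_sum (@tau123_linear _ _)).
under eq_bigr => s _ do
  rewrite (lin_sum (third_fus_linear s b)) scaler_sumr.
under [X in _ - X]eq_bigr => t _ do
  rewrite tens3E (lin_sum (second_fus_linear t a)) (lin_sum (@tau123_linear _ _))
    scaler_sumr.
(* The term at (s, t) of the first sum is matched with that at (t, s) of the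
   second. *)
rewrite [X in _ - X]exchange_big -sumrB scaler_sumr; apply: eq_bigr => s _.
rewrite -sumrB (bigD1 s) //= big1 ?addr0 => [|t /negbTE ts].
  have := third_second_fus s s a b z; rewrite eqxx => <-.
  rewrite (linZ (third_fus_linear _ _)) (linZ (second_fus_linear _ _)) tens3E.
  have -> : (4%:R : k)^-1 = 2%:R^-1 * 2%:R^-1 by rewrite -invfM -natrM.
  by lmod.
have := third_second_fus s t a b z; rewrite eq_sym ts => /eqP.
rewrite subr_eq0 => /eqP eq_st.
rewrite (linZ (third_fus_linear _ _)) (linZ (second_fus_linear _ _)) tens3E eq_st.
by lmod.
Qed.

(** Rewrites the summand in which the element of another piece differentiates the
    bracket of two elements of one piece; it cancels the terms that contain that
    bracket in the two other summands. *)
Lemma tau132_fus s z p q :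
  tau132 (pure (fus e s z p) q) =
  second_fus s (t2 p q) z + tau123 (third_fus s (t2 q p) z).
Proof.
rewrite /third_fus /second_fus /fus !(tens2E, tens3E) !outer_t2.
rewrite !(mul1r, mulr1) !mulrA -!/(t3 _ _ _) !(tau123_t3, tau132_t3); lmod.
Qed.

Lemma tau132_mixed al z p q :
  tau132 (pure (mixed e al z p) q) =
  second_mix al (t2 p q) z + tau123 (third_mix al (t2 q p) z).
Proof.
rewrite /mixed (lin_sum (pure_linearl q)) (lin_sum (@tau132_linear _ _)).
rewrite (lin_sum (@tau123_linear _ _)) -big_split; apply: eq_bigr => s _.
rewrite pureZl !(linZ (@tau132_linear _ _), linZ (@tau123_linear _ _)).
by rewrite tau132_fus; lmod.
Qed.

Variables (br : A -> A -> tens2 A) (db : is_double_bracket e br).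

Lemma bracketL_fus s a b z :
  bracketL br a (fus e s b z) = third_fus s (br a z) b + second_fus s (br a b) z.
Proof.
rewrite /fus !(bracketLD db, bracketLN db, bracketLE db) !(brMr db).
rewrite !(br_base db _ _).2 !(tens2E, tens3E) !outer_outer !(mul1r, mulr1).
by rewrite /third_fus /second_fus; lmod.
Qed.

Lemma bracketL_mixed al a b z :
  bracketL br a (mixed e al b z) =
  third_mix al (br a z) b + second_mix al (br a b) z.
Proof.
rewrite /mixed (lin_sum (bracketL_linear db a)) -big_split; apply: eq_bigr => s _.
by rewrite (bracketLZ db) bracketL_fus; lmod.
Qed.

End FusionTriple.

Section PushForward3.
Variables (k : fieldType) (A R : kalg k) (g : A -> R) (gm : nu_morphism g).

Definition push3 (r : tens3 A) : tens3 R :=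
  tlift (fun (t : tens2 A) (c : A) => pure (push2 g t) (g c) : tens3 R) r.

Lemma push3_bilinear :
  (forall c, linear (fun t : tens2 A => pure (push2 g t) (g c) : tens3 R)) /\
  (forall t, linear (fun c : A => pure (push2 g t) (g c) : tens3 R)).
Proof.
case: gm => gl _; split=> [c|t] l p q; last by rewrite gl pure_linearr.
by rewrite (push2_linear gm) pure_linearl.
Qed.

Lemma push3_linear : linear push3.
Proof. by have [? ?] := push3_bilinear; apply: tlift_linear. Qed.

Lemma push3_pure t c : push3 (pure t c) = pure (push2 g t) (g c).
Proof. by have [? ?] := push3_bilinear; rewrite /push3 tlift_pure. Qed.

Lemma push3_t3 x y z : push3 (t3 x y z) = t3 (g x) (g y) (g z).
Proof. by rewrite push3_pure push2_t2. Qed.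

Definition push3E := (lin0 push3_linear, linD push3_linear, linZ push3_linear,
  linN push3_linear).

Lemma push3_tau123 r : push3 (tau123 r) = tau123 (push3 r).
Proof.
elim/tensor_ind: r => [u x||? ?|? ?].
- elim/tensor_ind: u => [a b||? ?|? ?].
  + by rewrite -/(t2 a b) -/(t3 a b x) tau123_t3 !push3_t3 tau123_t3.
  + by rewrite !(tens3E, push3E).
  + by rewrite !(tens3E, push3E) => -> ->.
  + by rewrite !(tens3E, push3E) => ->.
- by rewrite !(tens3E, push3E).
- by rewrite !(tens3E, push3E) => -> ->.
- by rewrite !(tens3E, push3E) => ->.
Qed.

Lemma push3_tau132 r : push3 (tau132 r) = tau132 (push3 r).
Proof. by rewrite -!tau123_tau123 !push3_tau123. Qed.

Variables (I J : finType) (e : J -> A) (E : I -> R).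
Variables (br : A -> A -> tens2 A) (db : is_double_bracket e br).
Variables (Br : R -> R -> tens2 R) (DB : is_double_bracket E Br).
Hypothesis Brg : forall x y, Br (g x) (g y) = push2 g (br x y).

Lemma push3_bracketL x t :
  bracketL Br (g x) (push2 g t) = push3 (bracketL br x t).
Proof.
elim/tensor_ind: t => [a b||? ?|? ?].
- by rewrite -/(t2 a b) (bracketLE db) push3_pure push2_t2 // (bracketLE DB) Brg.
- by rewrite (bracketL0 db) (lin0 (push2_linear gm)) (bracketL0 DB) push3E.
- by rewrite (bracketLD db) (linD (push2_linear gm)) (bracketLD DB) push3E => -> ->.
- by rewrite (bracketLZ db) (linZ (push2_linear gm)) (bracketLZ DB) push3E => ->.
Qed.

Lemma push3_triple_bracket x y z :
  triple_bracket Br (g x) (g y) (g z) = push3 (triple_bracket br x y z).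
Proof.
by rewrite /triple_bracket !Brg !push3_bracketL !push3E push3_tau123 push3_tau132.
Qed.

Lemma push3_qP_term i j x y z : g (e j) = E i ->
  qP_term E i (g x) (g y) (g z) = push3 (qP_term e j x y z).
Proof. by case: gm => _ gM ge; rewrite /qP_term -ge !push3E !push3_t3 !gM. Qed.

End PushForward3.

(** * Color signs *)

Section ColorSigns.
Variables (k : fieldType) (I C : finType) (ord : I -> seq C).
Implicit Types (c d f : C) (s : I).

(** The order at s is continued to the colors that do not occur there.  Fusion
    terms of such colors vanish at s, and with a total order on all colors the
    sign identities hold at every vertex. *)
Definition color_rank s c : nat := index c (ord s ++ enum C).

Definition color_sign c d s : k :=
  if (color_rank s c < color_rank s d)%N then -1
  else if (color_rank s d < color_rank s c)%N then 1 else 0.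

Lemma color_rank_inj s : injective (color_rank s).
Proof.
move=> c d eq_cd; have in_l x : x \in ord s ++ enum C by rewrite mem_cat mem_enum orbT.
by rewrite -(nth_index c (in_l c)) -/(color_rank s c) eq_cd nth_index.
Qed.

Lemma color_signN c d s : color_sign d c s = - color_sign c d s.
Proof. by rewrite /color_sign; case: ltngtP; rewrite ?oppr0 ?opprK. Qed.

Lemma color_sign_sqr c d s : c != d -> color_sign c d s * color_sign c d s = 1.
Proof.
move=> cd; have := contra_neq (@color_rank_inj s c d) cd.
by rewrite /color_sign; case: ltngtP; rewrite ?mulrNN ?mulr1.
Qed.

(** Of the three products of signs exactly one is negative for each of the six
    orders of the colors. *)
Lemma color_sign_cyclic c d f s : c != d -> d != f -> f != c ->
  color_sign d f s * color_sign c f s + color_sign f c s * color_sign d c s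
  + color_sign c d s * color_sign f d s = 1.
Proof.
move=> cd df fc.
have := contra_neq (@color_rank_inj s c d) cd.
have := contra_neq (@color_rank_inj s d f) df.
have := contra_neq (@color_rank_inj s f c) fc.
rewrite /color_sign; move: (color_rank s c) (color_rank s d) (color_rank s f).
move=> x y z; case: (ltngtP x y) => // xy; case: (ltngtP y z) => // yz;
  case: (ltngtP z x) => // zx _ _ _; try ring.
  by move: (ltn_trans (ltn_trans xy yz) zx); rewrite ltnn.
by move: (ltn_trans (ltn_trans zx yz) xy); rewrite ltnn.
Qed.

End ColorSigns.

(** * Units in the corners e_s A e_s *)

Section CornerInverses.
Variables (k : fieldType) (I : finType) (A : kalg k) (e : I -> A).
Hypothesis e_fam : is_idempotent_family e.

Definition corner_unit s (x : A) := [/\ e s * x = x, x * e s = x &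
  exists y, [/\ e s * y = y, y * e s = y, x * y = e s & y * x = e s]].

Let eM : forall s t, e s * e t = if s == t then e s else 0.
Proof. by case: e_fam. Qed.

Lemma corner_unit1 s : corner_unit s (e s).
Proof. by rewrite /corner_unit eM eqxx; split=> //; exists (e s); rewrite eM eqxx. Qed.

Lemma corner_unitM s x y : corner_unit s x -> corner_unit s y -> corner_unit s (x * y).
Proof.
move=> [ex xe [x' [ex' xe' xx' x'x]]] [ey ye [y' [ey' ye' yy' y'y]]].
split; rewrite ?mulrA ?ex // -?mulrA ?ye //.
exists (y' * x'); split; rewrite ?mulrA ?ey' // -?mulrA ?xe' //.
  by rewrite (mulrA y) yy' ex'.
by rewrite (mulrA x') x'x ey.
Qed.

Lemma sum_corner (x : I -> A) s : (forall t, e t * x t = x t) ->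
  e s * \sum_t x t = x s.
Proof.
move=> ex; rewrite mulr_sumr (bigD1 s) //= ex big1 ?addr0 // => t /negbTE ts.
by rewrite -ex mulrA eM eq_sym ts mul0r.
Qed.

Lemma sum_cornerr (x : I -> A) s : (forall t, x t * e t = x t) ->
  (\sum_t x t) * e s = x s.
Proof.
move=> ex; rewrite mulr_suml (bigD1 s) //= ex big1 ?addr0 // => t /negbTE ts.
by rewrite -ex -mulrA eM ts mulr0.
Qed.

Lemma corner_unit_of_sum (x : I -> A) (y : A) :
  (forall s, e s * x s = x s) -> (forall s, x s * e s = x s) ->
  y * (\sum_s x s) = 1 -> (\sum_s x s) * y = 1 -> forall s, corner_unit s (x s).
Proof.
move=> ex xe yx xy s; split=> //.
have ess : e s * e s = e s by rewrite eM eqxx.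
have xsy : x s * y = e s by rewrite -(sum_corner s ex) -mulrA xy mulr1.
have yxs : y * x s = e s by rewrite -(sum_cornerr s xe) mulrA yx mul1r.
exists (e s * y * e s); split.
- by rewrite !mulrA ess.
- by rewrite -mulrA ess.
- by rewrite !mulrA xe xsy ess.
- by rewrite -!mulrA ex yxs ess.
Qed.

Lemma sum_of_corner_units (x : I -> A) : (forall s, corner_unit s (x s)) ->
  exists y, y * (\sum_s x s) = 1 /\ (\sum_s x s) * y = 1.
Proof.
move=> xu; have /choice[y yP] : forall s, exists y,
    [/\ e s * y = y, y * e s = y, x s * y = e s & y * x s = e s].
  by move=> s; case: (xu s).
have ex s : e s * x s = x s by case: (xu s).
have ey s : e s * y s = y s by case: (yP s).
have [_ e1] := e_fam.
exists (\sum_s y s); split; rewrite mulr_suml -e1; apply: eq_bigr => s _.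
  have [_ ye _ yx] := yP s.
  by rewrite -{1}ye -mulrA (sum_corner s ex).
have [_ xe _] := xu s; have [_ _ xy _] := yP s.
by rewrite -{1}xe -mulrA (sum_corner s ey).
Qed.

End CornerInverses.

(** * Coproducts of Hamiltonian algebras *)

Section CoproductHamiltonian.
Variables (k : fieldType) (I C : finType) (V : C -> {set I}).
Variables (A : kalg k) (e : I -> A).
Variables (P : C -> kalg k) (f : forall c, part_vert V c -> P c).
Variable (io : forall c, P c -> A).
Hypothesis cop : is_base_coproduct e f io.
Variables (pb : forall c, P c -> P c -> tens2 (P c)).
Variable (gam : forall c, part_vert V c -> P c).
Hypothesis pb_ham : forall c, is_hamiltonian (@f c) (@pb c) (@gam c).
Variable ord : I -> seq C.
Hypothesis ord_uniq : forall s, uniq (ord s).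
Hypothesis ord_mem : forall s c, (c \in ord s) = (s \in V c).
Variable G : C -> I -> A.
Hypothesis GE : forall c (s : part_vert V c), G c (val s) = io (gam s).

Local Notation eps := (color_sign k ord).

Let e_fam : is_idempotent_family e. Proof. by case: cop. Qed.
Let eM : forall s t, e s * e t = if s == t then e s else 0.
Proof. by case: e_fam. Qed.
Let iol c : linear (@io c).
Proof. by case: cop => _ /(_ c)[]. Qed.
Let ioM c (x y : P c) : io (x * y) = io x * io y.
Proof. by case: cop => _ /(_ c)[]. Qed.
Let ioe c (s : part_vert V c) : io (f s) = e (val s).
Proof. by case: cop. Qed.
Let iom c : nu_morphism (@io c). Proof. by case: cop. Qed.
Let pb_db c : is_double_bracket (@f c) (@pb c). Proof. by case: (pb_ham c). Qed.

Lemma io1 c : io (1 : P c) = \sum_(s in V c) e s.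
Proof.
case: (pb_ham c) => [[_ f1]] _ _ _; rewrite -f1 (lin_sum (@iol c)) [RHS]big_sub.
by apply: eq_bigr => s _; rewrite ioe.
Qed.

Lemma io_out c s (x : P c) : s \notin V c -> e s * io x = 0 /\ io x * e s = 0.
Proof.
move=> sV.
have e0 : e s * io (1 : P c) = 0 /\ io (1 : P c) * e s = 0.
  rewrite io1 mulr_sumr mulr_suml !big1 // => t tV; rewrite eM; case: eqP => // ts.
    by rewrite -ts tV in sV.
  by rewrite ts tV in sV.
by split; [rewrite -[x]mul1r ioM mulrA e0.1 mul0r
          |rewrite -[x]mulr1 ioM -mulrA e0.2 mulr0].
Qed.

Lemma G_unit c s : s \in V c -> corner_unit e s (G c s).
Proof.
move=> sV; pose s' : part_vert V c := Sub s sV.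
have [[fM f1] _ _ [[y [y1 y2]] gx _]] := pb_ham c.
have fgam (t : part_vert V c) : f t * gam t = gam t.
  by have [x ->] := gx t; rewrite !mulrA fM eqxx.
have gamf (t : part_vert V c) : gam t * f t = gam t.
  by have [x ->] := gx t; rewrite -!mulrA fM eqxx.
have [_ _ [z [fz zf gz zg]]] :=
  corner_unit_of_sum (conj fM f1) fgam gamf y1 y2 s'.
rewrite /corner_unit; have -> : G c s = io (gam s') by rewrite -GE.
have -> : e s = io (f s') by rewrite ioe.
split; rewrite -?ioM ?fgam ?gamf //.
by exists (io z); rewrite -!ioM fz zf gz zg.
Qed.

Definition color_prod s (l : seq C) : A := \big[*%R/e s]_(c <- l) G c s.

Lemma color_prod_unit s l : {subset l <= ord s} -> corner_unit e s (color_prod s l).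
Proof.
elim: l => [|c l IHl] sub_l; rewrite /color_prod ?big_nil ?big_cons.
  exact: corner_unit1.
apply: corner_unitM => //; first by apply: G_unit; rewrite -ord_mem sub_l ?mem_head.
by apply: IHl => d dl; apply: sub_l; rewrite inE dl orbT.
Qed.

Lemma color_prod_cat s l l' : {subset l <= ord s} -> {subset l' <= ord s} ->
  color_prod s (l ++ l') = color_prod s l * color_prod s l'.
Proof.
move=> sub_l sub_l'; elim: l sub_l => [|c l IHl] sub_l.
  by rewrite {2}/color_prod big_nil; case: (color_prod_unit sub_l').
rewrite /color_prod /= !big_cons -mulrA -!/(color_prod s _) IHl // => d dl.
by apply: sub_l; rewrite inE dl orbT.
Qed.

Section Bracket.
Variables (br : A -> A -> tens2 A) (db : is_double_bracket e br).
Hypothesis br_same : forall c (a b : P c),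
  br (io a) (io b) = push2 (@io c) (pb a b).
Hypothesis br_mixed : forall c d (a : P c) (b : P d), c != d ->
  br (io a) (io b) = mixed e (eps c d) (io a) (io b).

Let qp a b c := triple_bracket br a b c = qP_bracket e a b c.

Lemma qp_same c (a b z : P c) : qp (io a) (io b) (io z).
Proof.
rewrite /qp (push3_triple_bracket (iom c) (pb_db c) db) //.
have [_ _ -> _] := pb_ham c.
rewrite !qP_bracketE (linZ (push3_linear (iom c))) (lin_sum (push3_linear (iom c))).
congr (_ *: _); rewrite (bigID (mem (V c))) /= [X in _ + X]big1 ?addr0; last first.
  move=> s sV; have [ea ae] := io_out a sV; have [eb be] := io_out b sV.
  have [ez ze] := io_out z sV.
  by rewrite /qP_term !(ea, ae, eb, be, ez, ze) !(mul0r, mulr0, t30l, t30m, t30r); lmod.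
rewrite [RHS]big_sub. apply: eq_bigr => s _; apply/esym.
exact: (push3_qP_term (iom c)).
Qed.

Lemma qp_pair c d (a b : P c) (z : P d) : c != d -> qp (io a) (io b) (io z).
Proof.
move=> cd; have dc : d != c by rewrite eq_sym.
have epsN := color_signN k ord c d.
(* The bracket of z with br a b, expressed by that tensor itself. *)
have bracketLz (u : tens2 (P c)) : tau132 (bracketL br (io z) (push2 (@io c) u)) =
    second_mix e (eps d c) (push2 (@io c) u) (io z)
    + tau123 (third_mix e (eps d c) (tau12 (push2 (@io c) u)) (io z)).
  have p2l := push2_linear (iom c); have sl := second_mix_linear e (eps d c) (io z).
  have tl := third_mix_linear e (eps d c) (io z).
  elim/tensor_ind: u => [p q||u v|l u].
  - rewrite -/(t2 p q) (push2_t2 (iom c)) (bracketLE db) br_mixed // tau132_mixed //.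
    by rewrite tau12_t2.
  - by rewrite (lin0 p2l) (bracketL0 db) !tens2E (lin0 sl) (lin0 tl) !tens3E; lmod.
  - rewrite (linD p2l) (bracketLD db) !tens2E (linD sl) (linD tl) !tens3E => -> ->.
    by lmod.
  - by rewrite (linZ p2l) (bracketLZ db) !tens2E (linZ sl) (linZ tl) !tens3E => ->; lmod.
rewrite /qp /triple_bracket br_same bracketLz -br_same [br (io b) (io z)]br_mixed //.
rewrite [br (io z) (io a)]br_mixed // !(bracketL_mixed db).
rewrite [br (io a) (io z)]br_mixed // [br (io b) (io z)]br_mixed //.
rewrite third_second_mix // [br (io b) (io a)](brC db).
rewrite !(second_mixN _ _ _ epsN) !(third_mixN _ _ _ epsN).
rewrite (linN (third_mix_linear e _ _)) !tens3E qP_bracketE.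
rewrite [in RHS](eq_bigr (fun s => (eps c d s * eps c d s) *:
  qP_term e s (io a) (io b) (io z))); first by lmod.
by move=> s _; rewrite color_sign_sqr // scale1r.
Qed.

Lemma qp_distinct c d h (a : P c) (b : P d) (z : P h) :
  c != d -> d != h -> h != c -> qp (io a) (io b) (io z).
Proof.
move=> cd dh hc; have [dc hd ch] : [/\ d != c, h != d & c != h].
  by split; rewrite eq_sym.
have tau3 r : tau123 (tau123 (tau123 r)) = r :> tens3 A.
  by rewrite [tau123 (tau123 r)]tau123_tau123 tau123_tau132.
have rot al x y w : tau123 (\sum_s al s *: qP_term e s y w x) =
    \sum_s al s *: qP_term e s x y w.
  rewrite (lin_sum (@tau123_linear _ _)); apply: eq_bigr => s _.
  by rewrite (linZ (@tau123_linear _ _)) -qP_termC.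
rewrite /qp /triple_bracket -tau123_tau123 [br (io b) (io z)]br_mixed //.
rewrite [br (io z) (io a)]br_mixed // [br (io a) (io b)]br_mixed //.
rewrite !(bracketL_mixed db) !br_mixed // !third_second_mix //.
(* After this change of signs the summands that third_second_mix leaves over
   cancel in pairs. *)
rewrite (second_mixN _ _ _ (color_signN k ord h c)).
rewrite (second_mixN _ _ _ (color_signN k ord c d)).
rewrite (second_mixN _ _ _ (color_signN k ord d h)).
rewrite !tens3E !tau3 !rot qP_bracketE.
rewrite [in RHS](eq_bigr (fun s =>
  ((eps d h s * eps c h s) *: qP_term e s (io a) (io b) (io z)
   + (eps h c s * eps d c s) *: qP_term e s (io a) (io b) (io z))
  + (eps c d s * eps h d s) *: qP_term e s (io a) (io b) (io z))); last first.
  by move=> s _; rewrite -!scalerDl color_sign_cyclic // scale1r.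
by rewrite !big_split; lmod.
Qed.

Lemma quasi_poisson_coproduct : is_quasi_poisson e br.
Proof.
have [_ _ _ _ gen] := cop.
apply: (quasi_poisson_generators eM db (G := fun x => exists c (a : P c), x = io a)).
  by move=> S S0 Sl SM Se SG; apply: gen => // c x; apply: SG; exists c, x.
move=> _ _ _ [c [a ->]] [d [b ->]] [h [z ->]].
have [eq_cd|cd] := eqVneq c d.
  subst d; have [eq_ch|ch] := eqVneq c h; last exact: qp_pair.
  by subst h; apply: qp_same.
have [eq_dh|dh] := eqVneq d h.
  by subst h; apply: qp_rot; apply: qp_pair; rewrite eq_sym.
have [eq_hc|hc] := eqVneq h c.
  by subst h; do 2!apply: qp_rot; apply: qp_pair.
exact: qp_distinct.
Qed.

(** Twice the bracket of a moment map x at s with a.  For x in e_s A e_s it differs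
    from fus s x a in the signs of the last two terms. *)
Definition moment_term s (x a : A) : tens2 A :=
  t2 (a * e s) x - t2 (e s) (x * a) + t2 (a * x) (e s) - t2 x (e s * a).

Lemma fus_mull s x y a :
  fus e s (x * y) a = inner x (fus e s y a) 1 + inner 1 (fus e s x a) y.
Proof. by rewrite fusC fusM tau12D !tau12_outer -!fusC addrC. Qed.

Lemma fus_corner s x a : e s * x = x -> x * e s = x ->
  fus e s x a = t2 (a * e s) x - t2 (e s) (x * a) - t2 (a * x) (e s) + t2 x (e s * a).
Proof. by move=> ex xe; rewrite /fus -(mulrA a) ex xe. Qed.

Lemma fus_out s t x a : e s * x = x -> x * e s = x -> t != s -> fus e t x a = 0.
Proof.
move=> ex xe /negbTE ts.
have xt : x * e t = 0 by rewrite -xe -mulrA eM eq_sym ts mulr0.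
have tx : e t * x = 0 by rewrite -ex mulrA eM ts mul0r.
by rewrite /fus -(mulrA a) xt tx !(mulr0, mul0r) !(t20l, t20r); lmod.
Qed.

(** Over colors on one side of d the sign is constant, and both sides are inner
    derivations in the product. *)
Lemma br_color_prod s eta l d (a : P d) : {subset l <= ord s} ->
  (forall c, c \in l -> c != d /\ eps c d s = eta) ->
  br (color_prod s l) (io a) = (2%:R^-1 * eta) *: fus e s (color_prod s l) (io a).
Proof.
elim: l => [|c l IHl] sub_l eta_l; rewrite /color_prod ?big_nil ?big_cons.
  by rewrite (br_base db _ _).1 fusC fus_base // tau120 scaler0.
rewrite -/(color_prod s l) (brMl db) fus_mull IHl => [|x xl|x xl]; first last.
- by apply: eta_l; rewrite inE xl orbT.
- by apply: sub_l; rewrite inE xl orbT.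
have [cd eta_c] := eta_l c (mem_head _ _).
have sV : s \in V c by rewrite -ord_mem sub_l ?mem_head.
have -> : br (G c s) (io a) = (2%:R^-1 * eta) *: fus e s (G c s) (io a).
  have [eG Ge _] := G_unit sV.
  rewrite -[s in G c s]/(val (Sub s sV : part_vert V c)) GE br_mixed // -GE /=.
  rewrite /mixed (bigD1 s) //= big1 ?addr0 ?eta_c // => t /negbTE ts.
  by rewrite (fus_out _ eG Ge) ?ts // scaler0.
by rewrite !innerZ; lmod.
Qed.

(** Here p, g and q are the products over the colors before d, at d and after d.
    Of the four terms of g, two cancel against terms of p and two against terms
    of q. *)
Lemma moment_term_sandwich s p g q a :
  e s * p = p -> p * e s = p -> e s * g = g -> g * e s = g ->
  e s * q = q -> q * e s = q ->
  br p a = - (2%:R^-1 *: fus e s p a) -> br g a = 2%:R^-1 *: moment_term s g a ->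
  br q a = 2%:R^-1 *: fus e s q a ->
  br (p * (g * q)) a = 2%:R^-1 *: moment_term s (p * (g * q)) a.
Proof.
move=> ep pe eg ge eq qe brp brg brq; rewrite !(brMl db) brp brg brq.
rewrite !fus_corner // /moment_term !tens2E !inner_t2.
have pr x : x * p * e s = x * p by rewrite -mulrA pe.
have gr x : x * g * e s = x * g by rewrite -mulrA ge.
have gl x : x * e s * g = x * g by rewrite -mulrA eg.
have ql x : x * e s * q = x * q by rewrite -mulrA eq.
by rewrite !(mulr1, mul1r, mulrA, pr, gr, gl, ql, pe, ge, eg, eq); lmod.
Qed.

Lemma moment_map_gen s d (a : P d) :
  br (color_prod s (ord s)) (io a) =
  2%:R^-1 *: moment_term s (color_prod s (ord s)) (io a).
Proof.
(* A color d that does not occur at s ranks last there; then every term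
   vanishes. *)
have rank_lt c : c \in ord s -> d \notin ord s -> eps c d s = -1.
  move=> cs ds; rewrite /color_sign /color_rank !index_cat cs (negbTE ds).
  by rewrite ltn_addr // index_mem.
have [ds|ds] := boolP (d \in ord s); last first.
  have sV : s \notin V d by rewrite -ord_mem.
  have [ea ae] := io_out a sV.
  have [eF Fe _] := color_prod_unit (fun c (cs : c \in ord s) => cs).
  rewrite (br_color_prod (eta := -1)) // => [|c cs]; last first.
    by split; [apply: contraNneq ds => <-|apply: rank_lt].
  rewrite fus_corner // /moment_term -eF -Fe !mulrA -!(mulrA _ (e s) (io a)) ea ae.
  by rewrite !(mulr0, mul0r) !(t20l, t20r); lmod.
have [l1 [l2 ord_s]] : exists l1 l2, ord s = l1 ++ d :: l2.
  by move: (ord s) ds => l; case/splitPr=> l1 l2; exists l1, l2.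
have := ord_uniq s; rewrite {1}ord_s cat_uniq /= negb_or.
case/and3P=> _ /andP[dl1 /hasPn l12] /andP[dl2 _].
have rankd : color_rank ord s d = size l1.
  by rewrite /color_rank index_cat ds ord_s index_cat (negbTE dl1) /= eqxx addn0.
have l1_lt c : c \in l1 -> c != d /\ eps c d s = -1.
  move=> cl1; split; first by apply: contraNneq dl1 => <-.
  rewrite /color_sign rankd /color_rank index_cat ord_s mem_cat cl1 /=.
  by rewrite index_cat cl1 index_mem cl1.
have l2_gt c : c \in l2 -> c != d /\ eps c d s = 1.
  move=> cl2; have cd : c != d by apply: contraNneq dl2 => <-.
  split=> //; have cl1 : c \notin l1 by apply: l12.
  rewrite /color_sign rankd /color_rank index_cat ord_s mem_cat inE cl2 !orbT.
  rewrite index_cat (negbTE cl1) /= eq_sym (negbTE cd) addnS.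
  by rewrite ltnS leq_addr ltnNge ltnW // ltnS leq_addr.
have sub1 : {subset l1 <= ord s} by move=> c; rewrite ord_s mem_cat => ->.
have sub2 : {subset l2 <= ord s}.
  by move=> c; rewrite ord_s mem_cat inE => ->; rewrite !orbT.
have sub_d2 : {subset d :: l2 <= ord s}.
  by move=> c; rewrite ord_s mem_cat => ->; rewrite orbT.
have sV : s \in V d by rewrite -ord_mem.
have [eP Pe _] := color_prod_unit sub1; have [eQ Qe _] := color_prod_unit sub2.
have [eg ge _] := G_unit sV.
have -> : color_prod s (ord s) = color_prod s l1 * (G d s * color_prod s l2).
  by rewrite {1}ord_s color_prod_cat // {2}/color_prod big_cons.
apply: moment_term_sandwich => //.
- by rewrite (br_color_prod _ sub1 l1_lt); lmod.
- rewrite -[s in G d s]/(val (Sub s sV : part_vert V d)) GE br_same.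
  have [_ _ _ [_ _ ->]] := pb_ham d; set s' : part_vert V d := Sub s sV.
  rewrite (linZ (push2_linear (iom d))) !(linD (push2_linear (iom d))).
  rewrite !(linN (push2_linear (iom d))) !(push2_t2 (iom d)) !ioM -!GE !ioe.
  by rewrite /moment_term /=; lmod.
- by rewrite (br_color_prod _ sub2 l2_gt) mulr1.
Qed.

Lemma moment_term_der s x : e s * x = x -> x * e s = x ->
  outer_der id (fun a => 2%:R^-1 *: moment_term s x a) /\
  forall u, moment_term s x (e u) = 0.
Proof.
move=> ex xe; split; first split=> [l a b|a b]; rewrite /moment_term.
- rewrite !(mulrDl, mulrDr) !(mulZl, mulZr) !(t2Dl, t2Dr, t2Zl, t2Zr); lmod.
- by rewrite !tens2E !outer_t2 !(mul1r, mulr1) !mulrA; lmod.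
move=> u; have [->|us] := eqVneq u s; first by rewrite !eM eqxx ex xe; lmod.
have ux : e u * x = 0 by rewrite -ex mulrA eM (negbTE us) mul0r.
have xu : x * e u = 0 by rewrite -xe -mulrA eM eq_sym (negbTE us) mulr0.
by rewrite /moment_term -?mulrA !eM [s == u]eq_sym (negbTE us) ux xu !(t20l, t20r); lmod.
Qed.

Lemma moment_map_coproduct : is_moment_map e br (fun s => color_prod s (ord s)).
Proof.
have Phi_unit s : corner_unit e s (color_prod s (ord s)) by apply: color_prod_unit.
split=> [|s|a s]; first exact: (sum_of_corner_units e_fam Phi_unit).
  by exists (color_prod s (ord s)); case: (Phi_unit s) => -> ->.
have [ex xe _] := Phi_unit s; have [td t0] := moment_term_der ex xe.
apply: (coproduct_der_eq cop _ td) => [|u|c x].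
- by split=> [l x y|x y]; [apply: (br_linearr db)|apply: (brMr db)].
- by rewrite (br_base db _ _).2 t0 scaler0.
- exact: moment_map_gen.
Qed.

End Bracket.

Theorem coproduct_hamiltonian : exists br : A -> A -> tens2 A,
  is_hamiltonian e br (fun s => color_prod s (ord s)).
Proof.
have [br [db br_same br_mixed]] :=
  bracket_extension cop pb_db (color_signN k ord).
exists br; split=> //; first exact: quasi_poisson_coproduct.
exact: moment_map_coproduct.
Qed.

End CoproductHamiltonian.

(** * Universal properties of the presentations *)

Section Presentations.
Variables (k : fieldType) (R : kalg k).

Lemma nu0 (A : kalg k) (g : A -> R) : nu_morphism g -> g 0 = 0.
Proof. by case=> gl _; apply: lin0 gl. Qed.
Lemma nuD (A : kalg k) (g : A -> R) : nu_morphism g -> {morph g : x y / x + y}.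
Proof. by case=> gl _; apply: linD gl. Qed.
Lemma nuN (A : kalg k) (g : A -> R) : nu_morphism g -> {morph g : x / - x}.
Proof. by case=> gl _; apply: linN gl. Qed.
Lemma nuM (A : kalg k) (g : A -> R) : nu_morphism g -> {morph g : x y / x * y}.
Proof. by case. Qed.
Lemma nuB (A : kalg k) (g : A -> R) : nu_morphism g -> {morph g : x y / x - y}.
Proof. by move=> gm x y; rewrite (nuD gm) (nuN gm). Qed.
Lemma nu_sum (A : kalg k) (g : A -> R) (J : Type) (r : seq J) (P : pred J) (F : J -> A) :
  nu_morphism g -> g (\sum_(j <- r | P j) F j) = \sum_(j <- r | P j) g (F j).
Proof. by case=> gl _; apply: lin_sum. Qed.
Lemma nu1l (A : kalg k) (g : A -> R) x : nu_morphism g -> g 1 * g x = g x.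
Proof. by case=> _ gM; rewrite -gM mul1r. Qed.
Lemma nu1r (A : kalg k) (g : A -> R) x : nu_morphism g -> g x * g 1 = g x.
Proof. by case=> _ gM; rewrite -gM mulr1. Qed.

Section Free.
Variables (X : Type) (p : R) (h : X -> R).
Hypotheses (pp : p * p = p) (ph : forall x, p * h x = h x) (hp : forall x, h x * p = h x).

(** The unit of the free algebra is sent to p, a unit for all values of h. *)
Fixpoint feval (t : fterm k X) : R :=
  match t with
  | FGen x => h x
  | FZero => 0
  | FOne => p
  | FAdd x y => feval x + feval y
  | FMul x y => feval x * feval y
  | FScale c x => c *: feval x
  end.

Lemma feval_unit t : p * feval t = feval t /\ feval t * p = feval t.
Proof.
elim: t => [x|||x [xl xr] y [yl yr]|x [xl xr] y [yl yr]|c x [xl xr]] //=.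
- by rewrite mulr0 mul0r.
- by rewrite mulrDl mulrDr xl xr yl yr.
- by rewrite mulrA xl -mulrA yr.
- by rewrite mulZl mulZr xl xr.
Qed.

Lemma feval_eq x y : feq x y -> feval x = feval y.
Proof.
elim=> {x y} //=.
- by move=> y x z _ -> _ ->.
- by move=> x x' y y' _ -> _ ->.
- by move=> x x' y y' _ -> _ ->.
- by move=> c x x' _ ->.
- by move=> *; rewrite addrA.
- by move=> *; rewrite addrC.
- by move=> *; rewrite add0r.
- by move=> *; rewrite scaleN1r addNr.
- by move=> *; rewrite scalerA.
- by move=> *; rewrite scale1r.
- by move=> *; rewrite scalerDr.
- by move=> *; rewrite scalerDl.
- by move=> *; rewrite mulrA.
- by move=> x; case: (feval_unit x).
- by move=> x; case: (feval_unit x).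
- by move=> *; rewrite mulrDl.
- by move=> *; rewrite mulrDr.
- by move=> *; rewrite mulZl.
- by move=> *; rewrite mulZr.
Qed.

Lemma free_lift : exists g : freeAlg k X -> R,
  [/\ nu_morphism g, g 1 = p & forall x, g (fgen x) = h x].
Proof.
pose g (x : freeAlg k X) := feval (repr (x : free_car k X)).
have gpi t : g (\pi_(free_car k X) t) = feval t by apply/feval_eq/free_repr.
exists g; split=> [||x]; last exact: (gpi (FGen k x)).
  split=> [c|]; elim/free_ind=> x; elim/free_ind=> y.
    rewrite -[c *: _ + _]/(free_add (free_scale c _) _).
    by rewrite free_scaleE free_addE !gpi.
  by rewrite -[_ * _ in LHS]/(free_mul _ _) free_mulE !gpi.
exact: (gpi (FOne k X)).
Qed.

End Free.

Lemma quot_lift (A : kalg k) (S : A -> Prop) (g : A -> R) :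
  nu_morphism g -> (forall x, S x -> g x = 0) ->
  exists h : quotAlg S -> R, nu_morphism h /\ forall x, h (qproj S x) = g x.
Proof.
move=> gm gS; have g0 x : ideal_gen S x -> g x = 0.
  elim=> {x} [x /gS//||x y _ gx _ gy|a x b _ gx]; first exact: nu0.
    by rewrite (nuD gm) gx gy addr0.
  by rewrite !(nuM gm) gx mulr0 mul0r.
pose h (x : quotAlg S) := g (repr (x : quot_car S)).
have hE x : h (qproj S x) = g x.
  by apply/eqP; rewrite -subr_eq0 -(nuB gm); apply/eqP/g0/quot_repr.
have [gl gM] := gm.
exists h; split=> //; split=> [c|].
  elim/(@quot_ind _ _ S)=> x; elim/(@quot_ind _ _ S)=> y.
  rewrite -/(qproj S x) -/(qproj S y) -qproj_linear !hE; exact: gl.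
elim/(@quot_ind _ _ S)=> x; elim/(@quot_ind _ _ S)=> y.
by rewrite -/(qproj S x) -/(qproj S y) -qprojM !hE.
Qed.

End Presentations.

Lemma qproj_nu (k : fieldType) (A : kalg k) (S : A -> Prop) :
  nu_morphism (qproj S).
Proof. by split; [apply: qproj_linear | apply: qprojM]. Qed.

Lemma qproj_eq0 (k : fieldType) (A : kalg k) (S : A -> Prop) x :
  S x -> qproj S x = 0.
Proof.
by move=> Sx; rewrite -(nu0 (qproj_nu S)); apply/quot_piP; rewrite subr0; apply: ideal_in.
Qed.

Lemma quotAlg_ind (k : fieldType) (A : kalg k) (S : A -> Prop)
    (T : quotAlg S -> Prop) : (forall x, T (qproj S x)) -> forall x, T x.
Proof. by move=> Tq; apply: quot_ind. Qed.

(** Subalgebras that need not contain 1. *)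
Definition subalgebra_pred (k : fieldType) (A : kalg k) (S : A -> Prop) :=
  [/\ S 0, forall l x y, S x -> S y -> S (l *: x + y) &
      forall x y, S x -> S y -> S (x * y)].

Lemma subalgebra_preim (k : fieldType) (A R : kalg k) (g : A -> R) (S : R -> Prop) :
  nu_morphism g -> subalgebra_pred S -> subalgebra_pred (fun x => S (g x)).
Proof.
move=> gm [S0 Sl SM]; split=> [|l x y|x y]; first by rewrite nu0.
  by rewrite (proj1 gm); apply: Sl.
by rewrite (nuM gm); apply: SM.
Qed.

Lemma subalgebra_sum (k : fieldType) (A : kalg k) (S : A -> Prop) (J : finType)
    (F : J -> A) : subalgebra_pred S -> (forall j, S (F j)) -> S (\sum_j F j).
Proof.
case=> S0 Sl _ SF; elim/big_ind: _ => // x y Sx Sy.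
by rewrite -[x]scale1r; apply: Sl.
Qed.

Lemma freeAlg_ind (k : fieldType) (X : Type) (S : freeAlg k X -> Prop) :
  subalgebra_pred S -> S 1 -> (forall x, S (fgen x)) -> forall x, S x.
Proof.
case=> S0 Sl SM S1 Sg; elim/free_ind; elim=> [x|||x Sx y Sy|x Sx y Sy|c x Sx] //.
- exact: Sg.
- by have := Sl 1 _ _ Sx Sy; rewrite scale1r -[_ + _]/(free_add _ _) free_addE.
- by have := SM _ _ Sx Sy; rewrite -[_ * _]/(free_mul _ _) free_mulE.
- by have := Sl c _ _ Sx S0; rewrite addr0 -[_ *: _]/(free_scale _ _) free_scaleE.
Qed.

Section Localization.
Variables (k : fieldType) (A : kalg k) (J : Type) (x : J -> A).

Lemma uloc_map_nu : nu_morphism (uloc_map x).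
Proof.
have qm := qproj_nu (uloc_rel x).
split=> [c a b|a b]; apply/eqP; rewrite -subr_eq0; apply/eqP.
  rewrite -(proj1 qm) -(nuB qm); apply: qproj_eq0; exact: uloc_linear.
rewrite -(nuM qm) -(nuB qm); apply: qproj_eq0; exact: uloc_mul.
Qed.

Lemma uloc_map1 : uloc_map x 1 = 1.
Proof.
have qm := qproj_nu (uloc_rel x); apply/eqP; rewrite -subr_eq0; apply/eqP.
by rewrite -(qproj1 (uloc_rel x)) -(nuB qm); apply: qproj_eq0; exact: uloc_one.
Qed.

Lemma uloc_map_inv j : exists y, y * uloc_map x (x j) = 1 /\ uloc_map x (x j) * y = 1.
Proof.
have qm := qproj_nu (uloc_rel x).
exists (qproj (uloc_rel x) (fgen (inr j))).
rewrite /uloc_map -!(nuM qm) -(qproj1 (uloc_rel x)).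
split; apply/eqP; rewrite -subr_eq0 -(nuB qm); apply/eqP/qproj_eq0.
  exact: uloc_invl.
exact: uloc_invr.
Qed.

Lemma uloc_ind (S : uloc x -> Prop) : subalgebra_pred S ->
  (forall a, S (uloc_map x a)) ->
  (forall j y, y * uloc_map x (x j) = 1 -> uloc_map x (x j) * y = 1 -> S y) ->
  forall y, S y.
Proof.
have qm := qproj_nu (uloc_rel x).
move=> Ss Sa Si; apply: quotAlg_ind; apply: freeAlg_ind.
- exact: (subalgebra_preim qm Ss).
- by rewrite qproj1 -uloc_map1; apply: Sa.
case=> [a|j]; first exact: Sa.
apply: (Si j); rewrite /uloc_map -!(nuM qm) -(qproj1 (uloc_rel x));
  apply/eqP; rewrite -subr_eq0 -(nuB qm); apply/eqP/qproj_eq0.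
  exact: uloc_invl.
exact: uloc_invr.
Qed.

Lemma uloc_lift (R : kalg k) (g : A -> R) : nu_morphism g ->
  (forall j, exists y, [/\ g 1 * y = y, y * g 1 = y, y * g (x j) = g 1 &
     g (x j) * y = g 1]) ->
  exists h : uloc x -> R, nu_morphism h /\ forall a, h (uloc_map x a) = g a.
Proof.
move=> gm /choice[y yP].
pose h (z : A + J) := match z with inl a => g a | inr j => y j end.
have [|||F [Fm F1 Fg]] := @free_lift k R _ (g 1) h.
- exact: nu1l.
- by case=> [a|j] /=; [apply: nu1l | case: (yP j)].
- by case=> [a|j] /=; [apply: nu1r | case: (yP j)].
have [z zr|G [Gm GE]] := quot_lift (S := uloc_rel x) Fm; last first.
  by exists G; split=> // a; rewrite GE Fg.
case: zr => [c a b|a b||j|j]; rewrite (nuB Fm).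
- by rewrite (proj1 Fm) !Fg /= (proj1 gm) subrr.
- by rewrite (nuM Fm) !Fg /= (nuM gm) subrr.
- by rewrite F1 Fg subrr.
- by rewrite (nuM Fm) F1 !Fg /=; case: (yP j) => _ _ -> _; rewrite subrr.
- by rewrite (nuM Fm) F1 !Fg /=; case: (yP j) => _ _ _ ->; rewrite subrr.
Qed.

End Localization.

Section PathAlgebras.
Variables (k : fieldType) (I : finType) (Q : quiver I).

Lemma path_vertexM s t : path_vertex k Q s * path_vertex k Q t =
  if s == t then path_vertex k Q s else 0.
Proof.
have qm := qproj_nu (@path_rel k I Q).
have := qproj_eq0 (@path_orth k I Q s t); rewrite (nuB qm) (nuM qm) => /eqP.
by rewrite subr_eq0 => /eqP ->; case: (s == t); rewrite // (nu0 qm).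
Qed.

Lemma path_vertex_sum : \sum_s path_vertex k Q s = 1.
Proof.
have qm := qproj_nu (@path_rel k I Q).
have := qproj_eq0 (@path_one k I Q); rewrite (nuB qm) (nu_sum _ _ _ qm) => /eqP.
by rewrite subr_eq0 => /eqP ->.
Qed.

Lemma path_arrow_tgt a : path_vertex k Q (tgt a) * path_arrow k a = path_arrow k a.
Proof.
have qm := qproj_nu (@path_rel k I Q).
have := qproj_eq0 (@path_tgt k I Q a); rewrite (nuB qm) (nuM qm) => /eqP.
by rewrite subr_eq0 => /eqP.
Qed.

Lemma path_arrow_src a : path_arrow k a * path_vertex k Q (src a) = path_arrow k a.
Proof.
have qm := qproj_nu (@path_rel k I Q).
have := qproj_eq0 (@path_src k I Q a); rewrite (nuB qm) (nuM qm) => /eqP.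
by rewrite subr_eq0 => /eqP.
Qed.

Lemma path_ind (S : path_algebra k Q -> Prop) : subalgebra_pred S ->
  (forall s, S (path_vertex k Q s)) -> (forall a, S (path_arrow k a)) ->
  forall x, S x.
Proof.
have qm := qproj_nu (@path_rel k I Q).
move=> Ss Sv Sa; apply: quotAlg_ind; apply: freeAlg_ind.
- exact: (subalgebra_preim qm Ss).
- by rewrite qproj1 -path_vertex_sum; apply: subalgebra_sum.
by case.
Qed.

Lemma path_lift (R : kalg k) (E : I -> R) (phi : arrow Q -> R) :
  (forall s t, E s * E t = if s == t then E s else 0) ->
  (forall a, E (tgt a) * phi a = phi a) -> (forall a, phi a * E (src a) = phi a) ->
  exists g : path_algebra k Q -> R, [/\ nu_morphism g,
    forall s, g (path_vertex k Q s) = E s & forall a, g (path_arrow k a) = phi a].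
Proof.
move=> EM Ephi phiE; pose p := \sum_s E s.
have pE s : p * E s = E s /\ E s * p = E s.
  split; rewrite /p ?mulr_suml ?mulr_sumr (bigD1 s) //= EM eqxx big1 ?addr0 //.
    by move=> t /negbTE ts; rewrite EM ts.
  by move=> t /negbTE ts; rewrite EM eq_sym ts.
pose h z := match z with inl s => E s | inr a => phi a end.
have [||z|F [Fm F1 Fg]] := @free_lift k R _ p h.
- by rewrite /p mulr_sumr; apply: eq_bigr => s _; case: (pE s).
- case=> [s|a] /=; first by case: (pE s).
  by rewrite -Ephi mulrA (pE _).1.
- case: z => [s|a] /=; first by case: (pE s).
  by rewrite -phiE -mulrA (pE _).2.
have [z zr|G [Gm GE]] := quot_lift (S := @path_rel k I Q) Fm; last first.
  by exists G; split=> // a; rewrite GE Fg.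
case: zr => [s t||a|a]; rewrite (nuB Fm) ?(nuM Fm).
- by rewrite !Fg /= EM; case: (s == t); rewrite ?Fg ?(nu0 Fm) /= subrr.
- rewrite F1 (nu_sum _ _ _ Fm) -[X in _ - X]/(\sum_s E s).
  by under eq_bigr do rewrite Fg; rewrite subrr.
- by rewrite !Fg /= Ephi subrr.
- by rewrite !Fg /= phiE subrr.
Qed.

End PathAlgebras.

Lemma sum_sig (V : zmodType) (I : finType) (p P : pred I) (F : I -> V) :
  \sum_(i | p i && P i) F i = \sum_(x : {i | p i} | P (val x)) F (val x).
Proof.
rewrite (reindex_omap (val : {i | p i} -> I) insub) => [|i /andP[pi _]].
  by apply: eq_bigl => -[i pi] /=; rewrite insubT pi /= eqxx andbT.
by rewrite insubT.
Qed.

(** * Boalch algebras *)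

Section Boalch.
Variables (k : fieldType) (I C : finType) (Q : colored_quiver I C).

Lemma to_boalch_nu : nu_morphism (@to_boalch k I C Q).
Proof.
have qm := qproj_nu (@boalch_rel k I C Q).
have um := uloc_map_nu (@to_invert k I C Q).
split=> [c x y|x y]; rewrite /to_boalch; first by rewrite (proj1 um) (proj1 qm).
by rewrite (nuM um) (nuM qm).
Qed.

Lemma to_boalch1 : @to_boalch k I C Q 1 = 1.
Proof. by rewrite /to_boalch uloc_map1. Qed.

Lemma to_boalch_inv c : exists y, y * to_boalch (to_invert k Q c) = 1 /\
  to_boalch (to_invert k Q c) * y = 1.
Proof.
have qm := qproj_nu (@boalch_rel k I C Q).
have [y [yl yr]] := uloc_map_inv (@to_invert k I C Q) c.
by exists (qproj (@boalch_rel k I C Q) y); rewrite /to_boalch -!(nuM qm) yl yr.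
Qed.

Lemma to_boalch_rel c : to_boalch (v_minus k Q c * v_plus k Q c) =
  to_boalch (w_plus k Q c * gamma_sum k Q c * w_minus k Q c).
Proof.
have qm := qproj_nu (@boalch_rel k I C Q); apply/eqP; rewrite -subr_eq0.
by rewrite /to_boalch -(nuB qm); apply/eqP/qproj_eq0; exists c.
Qed.

Lemma boalch_ind (S : boalch k Q -> Prop) : subalgebra_pred S ->
  (forall s, S (boalch_e k Q s)) -> (forall a, S (to_boalch (tilde_arrow k a))) ->
  (forall c y, y * to_boalch (to_invert k Q c) = 1 ->
     to_boalch (to_invert k Q c) * y = 1 -> S y) -> forall x, S x.
Proof.
have qm := qproj_nu (@boalch_rel k I C Q).
move=> Ss Se Sa Si; apply: quotAlg_ind; apply: uloc_ind.
- exact: (subalgebra_preim qm Ss).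
- exact: (path_ind (subalgebra_preim to_boalch_nu Ss)).
- move=> c y yl yr; apply: (Si c); rewrite /to_boalch -(nuM qm) ?yl ?yr //.
Qed.

Lemma boalch_lift (R : kalg k) (g : tilde_algebra k Q -> R) : nu_morphism g ->
  (forall c, exists y, [/\ g 1 * y = y, y * g 1 = y, y * g (to_invert k Q c) = g 1 &
     g (to_invert k Q c) * y = g 1]) ->
  (forall c, g (v_minus k Q c * v_plus k Q c) =
     g (w_plus k Q c * gamma_sum k Q c * w_minus k Q c)) ->
  exists h : boalch k Q -> R, nu_morphism h /\ forall x, h (to_boalch x) = g x.
Proof.
move=> gm ginv grel; have [h [hm hE]] := uloc_lift gm ginv.
have [x [c ->]|H [Hm HE]] := quot_lift (S := @boalch_rel k I C Q) hm.
  by rewrite (nuB hm) !hE grel subrr.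
by exists H; split=> // x; rewrite /to_boalch HE hE.
Qed.

Lemma boalch_e_family : is_idempotent_family (boalch_e k Q).
Proof.
split=> [s t|]; rewrite /boalch_e.
  rewrite -(nuM to_boalch_nu) path_vertexM; case: (s == t) => //.
  exact: nu0 to_boalch_nu.
by rewrite -(nu_sum _ _ _ to_boalch_nu) path_vertex_sum to_boalch1.
Qed.

Lemma boalch_gamma_e c s :
  boalch_gamma k Q c s * boalch_e k Q s = boalch_gamma k Q c s.
Proof.
rewrite /boalch_gamma /boalch_e -(nuM (to_boalch_nu)) /gamma_arrow mulr_suml.
congr (to_boalch _); apply: eq_bigr => x /eqP xE.
by have := path_arrow_src k (inr (inr x) : arrow (tilde_quiver Q)); rewrite /= xE.
Qed.

End Boalch.

(** * The monochromatic quiver of a color *)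

Section Layer.
Variables (k : fieldType) (I C : finType) (Q : colored_quiver I C) (c : C).

Let V := cq_vert Q.

(** The number of arrows of a given color between two vertices is positive only
    if these are joined by an edge. *)
Lemma cq_arrow_vert (a : arrow Q) :
  src a \in V (cq_color a) /\ tgt a \in V (cq_color a).
Proof.
have := cq_arrows Q (cq_color a) (tgt a) (src a).
rewrite (cardD1 a) inE !eqxx /=; case E: (_ && _) => //= _.
by have /andP[/and3P[]] := E.
Qed.

Definition layer_vert : finType := part_vert V c.
Definition layer_quiver_arrow : finType := {a : arrow Q | cq_color a == c}.

Lemma layer_src_subproof (a : layer_quiver_arrow) : src (val a) \in V c.
Proof. by case: a => a /= /eqP <-; case: (cq_arrow_vert a). Qed.
Lemma layer_tgt_subproof (a : layer_quiver_arrow) : tgt (val a) \in V c.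
Proof. by case: a => a /= /eqP <-; case: (cq_arrow_vert a). Qed.

Definition layer_quiver : quiver layer_vert :=
  @Quiver layer_vert layer_quiver_arrow
    (fun a => Sub (src (val a)) (layer_src_subproof a))
    (fun a => Sub (tgt (val a)) (layer_tgt_subproof a)).

Let M := cq_layer Q c.

Lemma layer_part_lt (i : layer_vert) : i \in [set: layer_vert] ->
  (mp_part M (val i) < mp_size M)%N.
Proof. by move=> _; apply: mp_part_lt; apply: valP. Qed.

Lemma layer_part_nonempty p : (p < mp_size M)%N ->
  exists2 i : layer_vert, i \in [set: layer_vert] & mp_part M (val i) = p.
Proof.
move=> /mp_part_nonempty[i iV ip].
by exists (Sub i iV : layer_vert); rewrite ?inE.
Qed.

Lemma layer_ord_irr :
  {in [set: layer_vert], irreflexive (fun i j => mp_ord M (val i) (val j))}.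
Proof. by move=> i _; apply: (mp_ord_irr (m := M)); apply: valP. Qed.

Lemma layer_ord_trans : {in [set: layer_vert] & &, forall i j l,
  mp_part M (val j) = mp_part M (val i) -> mp_part M (val l) = mp_part M (val i) ->
  mp_ord M (val i) (val j) -> mp_ord M (val j) (val l) ->
  mp_ord M (val i) (val l)}.
Proof. by move=> i j l _ _ _; apply: mp_ord_trans; apply: valP. Qed.

Lemma layer_ord_total : {in [set: layer_vert] &, forall i j,
  mp_part M (val i) = mp_part M (val j) -> i != j ->
  mp_ord M (val i) (val j) || mp_ord M (val j) (val i)}.
Proof. by move=> i j _ _ ij; rewrite -val_eqE; apply: mp_ord_total => //; apply: valP. Qed.

Definition layer_multipartite : multipartite layer_vert :=
  @Multipartite layer_vert [set: layer_vert] (mp_size M)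
    (fun i => mp_part M (val i)) (fun i j => mp_ord M (val i) (val j))
    (mp_size_gt0 M) layer_part_lt layer_part_nonempty layer_ord_irr
    layer_ord_trans layer_ord_total.

Lemma layer_arrows (u : unit) (i j : layer_vert) :
  #|[set a : arrow layer_quiver | [&& tt == u, src a == j & tgt a == i]]| =
  (mp_edge layer_multipartite i j && mp_lt layer_multipartite i j) :> nat.
Proof.
rewrite /mp_edge /= !inE /=; have := cq_arrows Q c (val i) (val j).
rewrite /mp_edge (valP i) (valP j) /= => <-.
rewrite -(card_imset _ val_inj); apply: eq_card => a; rewrite [RHS]inE.
apply/imsetP/and3P => [[b bP ->]|[ac sj ti]].
  by move: bP; rewrite inE => /andP[/eqP <- /eqP <-]; split=> //=; exact: (valP b).
exists (Sub a ac : layer_quiver_arrow) => //.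
by rewrite inE; case: u; rewrite -!val_eqE /= sj ti.
Qed.

Definition layer : colored_quiver layer_vert unit :=
  @ColoredQuiver layer_vert unit layer_quiver (fun=> tt)
    (fun=> layer_multipartite) layer_arrows.

Lemma layer_monochromatic : monochromatic layer.
Proof. by split; first rewrite card_unit. Qed.

Lemma layer_ordering : color_ordering layer (fun=> [:: tt]).
Proof. by move=> s; split=> // -[]; rewrite inE [RHS]inE. Qed.

Lemma layer_w_subproof (x : w_index layer) :
  [&& val (val x).1.2 \in V c, val (val x).2 \in V c & val (val x).1.2 != val (val x).2].
Proof.
case: x => [[[u i] j]] /= /and3P[_ _]; rewrite -val_eqE => ij.
by apply/and3P; split=> //; [exact: (valP i) | exact: (valP j)].
Qed.

Definition layer_w (x : w_index layer) : w_index Q :=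
  exist _ (c, val (val x).1.2, val (val x).2) (layer_w_subproof x).

Definition layer_gamma (x : gamma_index layer) : gamma_index Q :=
  exist _ (c, val (val x).2) (valP (val x).2).

Definition layer_arrow (a : arrow (tilde_quiver layer)) : arrow (tilde_quiver Q) :=
  match a with
  | inl (inl b) => inl (inl (val b))
  | inl (inr b) => inl (inr (val b))
  | inr (inl x) => inr (inl (layer_w x))
  | inr (inr x) => inr (inr (layer_gamma x))
  end.

Lemma src_layer_arrow a : src (layer_arrow a) = val (src a).
Proof. by case: a => [[a|a]|[a|a]]. Qed.
Lemma tgt_layer_arrow a : tgt (layer_arrow a) = val (tgt a).
Proof. by case: a => [[a|a]|[a|a]]. Qed.

Lemma layer_arrow_inj : injective layer_arrow.
Proof.
move=> [[a|a]|[a|a]] [[b|b]|[b|b]] //= [].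
- by move/val_inj->.
- by move/val_inj->.
- case: a b => [[[[] i] j] ap] [[[[] i'] j'] bp] /= /val_inj ii /val_inj jj.
  by congr (inr (inl _)); apply: val_inj; rewrite /= ii jj.
- case: a b => [[[] i] ap] [[[] i'] bp] /= /val_inj ii.
  by congr (inr (inr _)); apply: val_inj; rewrite /= ii.
Qed.

Lemma layer_tilde_exists : exists g : tilde_algebra k layer -> tilde_algebra k Q,
  [/\ nu_morphism g,
      forall s, g (path_vertex k _ s) = path_vertex k (tilde_quiver Q) (val s) &
      forall a, g (tilde_arrow k a) = tilde_arrow k (layer_arrow a)].
Proof.
apply: path_lift => [s t|a|a].
- by rewrite path_vertexM val_eqE.
- by rewrite -tgt_layer_arrow path_arrow_tgt.
- by rewrite -src_layer_arrow path_arrow_src.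
Qed.

Definition layer_tilde := sval (cid layer_tilde_exists).
Local Notation j := layer_tilde.

Lemma layer_tilde_nu : nu_morphism j.
Proof. by rewrite /layer_tilde; case: cid => g []. Qed.
Lemma layer_tilde_vertex s :
  j (path_vertex k _ s) = path_vertex k (tilde_quiver Q) (val s).
Proof. by rewrite /layer_tilde; case: cid => g []. Qed.
Lemma layer_tilde_arrow a : j (tilde_arrow k a) = tilde_arrow k (layer_arrow a).
Proof. by rewrite /layer_tilde; case: cid => g []. Qed.

Lemma layer_color_one : color_one k layer tt = 1.
Proof. by rewrite -path_vertex_sum; apply: eq_bigl => s; rewrite inE. Qed.

Lemma layer_tilde1 : j 1 = color_one k Q c.
Proof.
rewrite -path_vertex_sum (nu_sum _ _ _ layer_tilde_nu) /color_one [RHS]big_sub.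
by apply: eq_bigr => s _; apply: layer_tilde_vertex.
Qed.

Lemma layer_tilde_v s t :
  j (v_arrow k layer tt s t) = v_arrow k Q c (val s) (val t).
Proof.
rewrite (nu_sum _ _ _ layer_tilde_nu) /v_arrow !big_sumType /=.
congr (_ + _); rewrite [RHS]sum_sig; apply: eq_big => a; rewrite -?val_eqE //.
- by rewrite layer_tilde_arrow.
- by rewrite layer_tilde_arrow.
Qed.

Lemma layer_tilde_w s t :
  j (w_arrow k layer tt s t) = w_arrow k Q c (val s) (val t).
Proof.
rewrite (nu_sum _ _ _ layer_tilde_nu) /w_arrow.
have [->|st] := eqVneq s t.
  by rewrite !big1 // => y /eqP yE; case/and3P: (valP y) => _ _; rewrite yE eqxx.
have stP : [&& s \in cq_vert layer tt, t \in cq_vert layer tt & s != t] by rewrite !inE.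
pose x : w_index layer := exist _ (tt, s, t) stP.
rewrite (big_pred1 x) => [|y]; last exact: (val_eqE y x).
rewrite (big_pred1 (layer_w x)) => [|y]; last exact: (val_eqE y (layer_w x)).
exact: layer_tilde_arrow.
Qed.

Lemma layer_tilde_gamma s :
  j (gamma_arrow k layer tt s) = gamma_arrow k Q c (val s).
Proof.
rewrite (nu_sum _ _ _ layer_tilde_nu) /gamma_arrow.
have sP : s \in cq_vert layer tt by rewrite inE.
pose x : gamma_index layer := exist _ (tt, s) sP.
rewrite (big_pred1 x) => [|y]; last exact: (val_eqE y x).
rewrite (big_pred1 (layer_gamma x)) => [|y]; last exact: (val_eqE y (layer_gamma x)).
exact: layer_tilde_arrow.
Qed.

Lemma layer_tilde_sum2 (lt : rel I) (F : layer_vert -> layer_vert -> tilde_algebra k layer)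
    (G : I -> I -> tilde_algebra k Q) :
  (forall s t, j (F s t) = G (val s) (val t)) ->
  j (\sum_(s in [set: layer_vert])
       \sum_(t in [set: layer_vert] | lt (val s) (val t)) F s t) =
  \sum_(s in V c) \sum_(t in V c | lt s t) G s t.
Proof.
move=> FG; rewrite (nu_sum _ _ _ layer_tilde_nu) [RHS]big_sub.
apply: eq_big => [s|s _]; first by rewrite inE.
rewrite (nu_sum _ _ _ layer_tilde_nu) [RHS]sum_sig.
by apply: eq_big => [t|t _]; rewrite ?inE.
Qed.

Lemma layer_tilde_color_one : j (color_one k layer tt) = color_one k Q c.
Proof. by rewrite layer_color_one layer_tilde1. Qed.

Lemma layer_tilde_v_plus : j (v_plus k layer tt) = v_plus k Q c.
Proof.
rewrite (nuD layer_tilde_nu) layer_tilde_color_one; congr (_ + _).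
exact: (layer_tilde_sum2 (cq_lt Q c) layer_tilde_v).
Qed.

Lemma layer_tilde_v_minus : j (v_minus k layer tt) = v_minus k Q c.
Proof.
rewrite (nuD layer_tilde_nu) layer_tilde_color_one; congr (_ + _).
exact: (layer_tilde_sum2 (fun s t => cq_lt Q c t s) layer_tilde_v).
Qed.

Lemma layer_tilde_w_plus : j (w_plus k layer tt) = w_plus k Q c.
Proof.
rewrite (nuD layer_tilde_nu) layer_tilde_color_one; congr (_ + _).
exact: (layer_tilde_sum2 (cq_lt Q c) layer_tilde_w).
Qed.

Lemma layer_tilde_w_minus : j (w_minus k layer tt) = w_minus k Q c.
Proof.
rewrite (nuD layer_tilde_nu) layer_tilde_color_one; congr (_ + _).
exact: (layer_tilde_sum2 (fun s t => cq_lt Q c t s) layer_tilde_w).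
Qed.

Lemma layer_tilde_gamma_sum : j (gamma_sum k layer tt) = gamma_sum k Q c.
Proof.
rewrite (nu_sum _ _ _ layer_tilde_nu) /gamma_sum [RHS]big_sub.
by apply: eq_big => [s|s _]; rewrite ?inE // layer_tilde_gamma.
Qed.

Lemma layer_to_invert : to_invert k layer tt = gamma_sum k layer tt.
Proof. by rewrite /to_invert layer_color_one subrr add0r. Qed.

(** In the corner of color c, the element inverted in A is gamma_c itself, since
    1 - 1_c vanishes there; its inverse is the compression of the inverse in A. *)
Lemma layer_map_exists : exists h : boalch k layer -> boalch k Q,
  nu_morphism h /\ forall x, h (to_boalch x) = to_boalch (j x).
Proof.
have jm := layer_tilde_nu; have bm := to_boalch_nu k Q.
pose g x := to_boalch (j x).
have gm : nu_morphism g.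
  by split=> [l x y|x y]; rewrite /g ?(proj1 jm) ?(proj1 bm) // (nuM jm) (nuM bm).
apply: (boalch_lift gm) => -[]; last first.
  rewrite /g !(nuM jm) layer_tilde_v_plus layer_tilde_v_minus layer_tilde_w_plus.
  by rewrite layer_tilde_w_minus layer_tilde_gamma_sum to_boalch_rel.
have [y [yl yr]] := to_boalch_inv k Q c.
have invE : g (to_invert k layer tt) = to_boalch (gamma_sum k Q c).
  by rewrite /g layer_to_invert layer_tilde_gamma_sum.
have g1E : g 1 = to_boalch (color_one k Q c) by rewrite /g layer_tilde1.
have gg : g 1 * g 1 = g 1 by rewrite nu1l.
have gl : to_boalch (to_invert k Q c) * g 1 = g (to_invert k layer tt).
  rewrite /to_invert (nuD bm) (nuB bm) to_boalch1 -g1E mulrDl mulrBl mul1r gg subrr.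
  by rewrite add0r -invE nu1r.
have gr : g 1 * to_boalch (to_invert k Q c) = g (to_invert k layer tt).
  rewrite /to_invert (nuD bm) (nuB bm) to_boalch1 -g1E mulrDr mulrBr mulr1 gg subrr.
  by rewrite add0r -invE nu1l.
exists (g 1 * y * g 1); split.
- by rewrite !mulrA gg.
- by rewrite -mulrA gg.
- by rewrite -mulrA nu1l // -gl -mulrA (mulrA y) yl mul1r gg.
- by rewrite !mulrA nu1r // -gr -(mulrA _ _ y) yr mulr1 gg.
Qed.

Definition layer_map := sval (cid layer_map_exists).

Lemma layer_map_nu : nu_morphism layer_map.
Proof. by rewrite /layer_map; case: cid => h []. Qed.
Lemma layer_map_to_boalch x : layer_map (to_boalch x) = to_boalch (j x).
Proof. by rewrite /layer_map; case: cid => h []. Qed.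

Lemma layer_map_e s : layer_map (boalch_e k layer s) = boalch_e k Q (val s).
Proof. by rewrite layer_map_to_boalch layer_tilde_vertex. Qed.

Lemma layer_map_gamma s :
  layer_map (boalch_gamma k layer tt s) = boalch_gamma k Q c (val s).
Proof. by rewrite layer_map_to_boalch layer_tilde_gamma. Qed.

End Layer.

(** * Boalch algebras as coproducts over the colors *)

Section Decomposition.
Variables (k : fieldType) (I C : finType) (Q : colored_quiver I C).

Definition tilde_color (a : arrow (tilde_quiver Q)) : C :=
  match a with
  | inl b => double_color b
  | inr (inl x) => (val x).1.1
  | inr (inr x) => (val x).1
  end.

Lemma tilde_color_layer c (a : arrow (tilde_quiver (layer Q c))) :
  tilde_color (layer_arrow a) = c.
Proof. by case: a => [[a|a]|[a|a]] //=; apply/eqP/(valP a). Qed.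

Lemma layer_arrow_surj (a : arrow (tilde_quiver Q)) :
  exists c (b : arrow (tilde_quiver (layer Q c))), layer_arrow b = a.
Proof.
case: a => [[a|a]|[[[[c i] j] ijP]|[[c i] iP]]].
- by exists (cq_color a), (inl (inl (exist _ a (eqxx _)))).
- by exists (cq_color a), (inl (inr (exist _ a (eqxx _)))).
- have /= /and3P[iV jV ij] := ijP; exists c.
  pose i' : layer_vert Q c := exist _ i iV; pose j' : layer_vert Q c := exist _ j jV.
  have ijP' : [&& i' \in cq_vert (layer Q c) tt, j' \in cq_vert (layer Q c) tt & i' != j'].
    by rewrite !inE.
  exists (inr (inl (exist _ (tt, i', j') ijP'))).
  by congr (inr (inl _)); apply: val_inj.
- exists c; pose i' : layer_vert Q c := exist _ i iP.
  have iP' : i' \in cq_vert (layer Q c) tt by rewrite inE.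
  exists (inr (inr (exist _ (tt, i') iP'))).
  by congr (inr (inr _)); apply: val_inj.
Qed.

(** Each arrow of the enlarged quiver belongs to exactly one color. *)
Lemma layer_arrow_family (R : Type)
    (h : forall c, arrow (tilde_quiver (layer Q c)) -> R) :
  exists phi : arrow (tilde_quiver Q) -> R,
    forall c (b : arrow (tilde_quiver (layer Q c))), phi (layer_arrow b) = h c b.
Proof.
suff /choice[phi phiP] : forall a, exists r, forall c (b : arrow (tilde_quiver (layer Q c))),
    layer_arrow b = a -> r = h c b by exists phi => c b; apply: phiP.
move=> a; have [c [b ba]] := layer_arrow_surj a; exists (h c b) => d b' b'a.
have cd : c = d by rewrite -(tilde_color_layer b) ba -b'a tilde_color_layer.
by subst d; congr (h c _); apply: layer_arrow_inj; rewrite ba b'a.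
Qed.

Local Notation io c := (@layer_map k I C Q c).

Lemma layer_inv c : exists y : boalch k (layer Q c),
  y * to_boalch (gamma_sum k (layer Q c) tt) = 1 /\
  to_boalch (gamma_sum k (layer Q c) tt) * y = 1.
Proof. by rewrite -layer_to_invert; apply: to_boalch_inv. Qed.

(** A map that restricts to g on color c inverts to_invert c: it is 1 off the
    corner with unit g 1, and the image of an invertible element in it. *)
Lemma corner_to_invert (R : kalg k) (F : tilde_algebra k Q -> R) c
    (g : boalch k (layer Q c) -> R) : nu_morphism F -> F 1 = 1 -> nu_morphism g ->
  (forall x, F (@layer_tilde k I C Q c x) = g (to_boalch x)) ->
  exists y, (1 - g 1 + g y) * F (to_invert k Q c) = 1 /\
            F (to_invert k Q c) * (1 - g 1 + g y) = 1.
Proof.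
move=> Fm F1 gm Fg; have [y [yl yr]] := layer_inv c; exists y.
have -> : F (to_invert k Q c) = 1 - g 1 + g (to_boalch (gamma_sum k (layer Q c) tt)).
  rewrite /to_invert (nuD Fm) (nuB Fm) F1 -layer_tilde1 -layer_tilde_gamma_sum !Fg.
  by rewrite to_boalch1.
have ann a : (1 - g 1) * g a = 0 /\ g a * (1 - g 1) = 0.
  by rewrite mulrBl mulrBr mul1r mulr1 nu1l // nu1r // subrr.
have idem : (1 - g 1) * (1 - g 1) = 1 - g 1.
  by rewrite mulrBr mulr1 (ann 1).1 subr0.
have : 1 - g 1 + g 1 = 1 by rewrite subrK.
move: (1 - g 1) ann idem => q ann qq q1.
by split; rewrite mulrDl !mulrDr qq (ann _).1 (ann _).2 -(nuM gm) ?yl ?yr addr0 add0r.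
Qed.

Lemma boalch_coproduct_gen :
  coproduct_gen (boalch_e k Q) (fun c => io c).
Proof.
move=> S S0 Sl SM Se Sio.
have Ss : subalgebra_pred S by split.
have bm := to_boalch_nu k Q.
have S1 : S 1 by rewrite -(proj2 (boalch_e_family k Q)); apply: subalgebra_sum.
apply: boalch_ind => // [a|c y yl yr].
  have [c [b <-]] := layer_arrow_surj a.
  by rewrite -layer_tilde_arrow -layer_map_to_boalch.
have [z [zl zr]] := corner_to_invert bm (to_boalch1 k Q) (layer_map_nu k Q c)
  (fun x => esym (layer_map_to_boalch x)).
have -> : y = 1 - io c 1 + io c z by rewrite -[LHS]mulr1 -[X in y * X = _]zr mulrA yl mul1r.
have -> : 1 - io c 1 + io c z = 1 *: (-1 *: io c 1 + 1) + io c z.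
  by rewrite scale1r scaleN1r addrC [- _ + _]addrC addrC.
by apply: (Sl) => //; apply: (Sl).
Qed.

Lemma boalch_coproduct_ext : coproduct_ext (V := cq_vert Q) (boalch_e k Q)
  (fun c => boalch_e k (layer Q c)) (fun c => io c).
Proof.
move=> R E g [EM E1] gm gE.
have [phi phiE] := layer_arrow_family (fun c b => g c (to_boalch (tilde_arrow k b))).
have bm c := to_boalch_nu k (layer Q c).
have phi_tgt a : E (tgt a) * phi a = phi a.
  have [c [b <-]] := layer_arrow_surj a.
  rewrite phiE tgt_layer_arrow -gE -(nuM (gm c)) -(nuM (bm c)).
  by congr (g c (to_boalch _)); apply: path_arrow_tgt.
have phi_src a : phi a * E (src a) = phi a.
  have [c [b <-]] := layer_arrow_surj a.
  rewrite phiE src_layer_arrow -gE -(nuM (gm c)) -(nuM (bm c)).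
  by congr (g c (to_boalch _)); apply: path_arrow_src.
have [F [Fm Fv Fa]] := path_lift EM phi_tgt phi_src.
have F1 : F 1 = 1.
  rewrite -path_vertex_sum (nu_sum _ _ _ Fm) -E1.
  by apply: eq_bigr => s _; apply: Fv.
have Fj c x : F (@layer_tilde k I C Q c x) = g c (to_boalch x).
  move: x; apply: path_ind => [|s|a].
  - have jm := layer_tilde_nu k Q c.
    split=> [|l x y ex ey|x y ex ey].
    + by rewrite (nu0 jm) (nu0 Fm) (nu0 (bm c)) (nu0 (gm c)).
    + by rewrite (proj1 jm) (proj1 Fm) (proj1 (bm c)) (proj1 (gm c)) ex ey.
    + by rewrite (nuM jm) (nuM Fm) (nuM (bm c)) (nuM (gm c)) ex ey.
  - by rewrite layer_tilde_vertex Fv -gE.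
  - by rewrite layer_tilde_arrow Fa phiE.
have [c|c|H [Hm HE]] := boalch_lift Fm.
- have [y [yl yr]] := corner_to_invert Fm F1 (gm c) (Fj c).
  by exists (1 - g c 1 + g c y); rewrite F1 mul1r mulr1 yl yr.
- rewrite !(nuM Fm) -layer_tilde_v_plus -layer_tilde_v_minus -layer_tilde_w_plus.
  rewrite -layer_tilde_w_minus -layer_tilde_gamma_sum !Fj -!(nuM (gm c)).
  by rewrite -!(nuM (bm c)) to_boalch_rel.
exists H; split=> [//||s|c x]; first by rewrite -to_boalch1 HE.
  by rewrite HE Fv.
have lm := layer_map_nu k Q c.
have Hj y : H (io c (to_boalch y)) = g c (to_boalch y).
  by rewrite layer_map_to_boalch HE Fj.
move: x; apply: boalch_ind => [|s|a|[] y yl yr].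
- split=> [|l x y ex ey|x y ex ey].
  + by rewrite (nu0 lm) (nu0 Hm) (nu0 (gm c)).
  + by rewrite (proj1 lm) (proj1 Hm) (proj1 (gm c)) ex ey.
  + by rewrite (nuM lm) (nuM Hm) (nuM (gm c)) ex ey.
- exact: Hj.
- exact: Hj.
(* H (io c y) and g c y are inverse to the same element of the corner with unit
   g c 1. *)
set t := to_boalch _ in yl yr.
have H1 : H (io c 1) = g c 1 by rewrite -to_boalch1 Hj.
rewrite -[y in LHS]mulr1 (nuM lm) (nuM Hm) H1 -yr (nuM (gm c)) -Hj mulrA.
by rewrite -(nuM Hm) -(nuM lm) yl H1 nu1l.
Qed.

Lemma boalch_base_coproduct : is_base_coproduct (V := cq_vert Q) (boalch_e k Q)
  (fun c => boalch_e k (layer Q c)) (fun c => io c).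
Proof.
split; first exact: boalch_e_family.
- by move=> c; apply: layer_map_nu.
- by move=> c s; apply: layer_map_e.
- exact: boalch_coproduct_ext.
- exact: boalch_coproduct_gen.
Qed.

End Decomposition.

Theorem lemma3p11 (k : fieldType) (k_char0 : [pchar k] =i pred0) :
  (forall (I C : finType) (Q : colored_quiver I C) (ord : I -> seq C),
     monochromatic Q -> color_ordering Q ord -> boalch_hamiltonian k Q ord) ->
  forall (I C : finType) (Q : colored_quiver I C) (ord : I -> seq C),
    color_ordering Q ord -> boalch_hamiltonian k Q ord.
Proof.
move=> mono I C Q ord ordP.
have ham c := cid (mono _ _ _ _ (layer_monochromatic Q c) (@layer_ordering I C Q c)).
apply: (@coproduct_hamiltonian k I C _ _ _ _ _ _ (boalch_base_coproduct k Q) _ _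
  (fun c => svalP (ham c)) ord _ _ (boalch_gamma k Q)) => [s|s c|c s].
- by case: (ordP s).
- by case: (ordP s).
rewrite /boalch_phi big_cons big_nil boalch_gamma_e.
exact/esym/layer_map_gamma.
Qed.
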